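(* Suppose $\Pi=K(S)$ for some $S\in\mathrm{SYT}(n)$. Then the following are equivalent: (i) $\Pi$ is pattern-Knuth closed; (ii) $\Pi$ is swap closed; (iii) $\Pi=D_J^{-1}$ where $J=[1,k]$ or $J=[k,n-1]$ for some $k$ (with $J\subseteq[n-1]$; the empty intervals $[1,0]=[n,n-1]=\emptyset$ are allowed); (iv) $S$ is a superstandard hook.
   Context: $\mathfrak S_n$ is the set of permutations $\pi=\pi_1\cdots\pi_n$ of $[n]=\{1,\dots,n\}$, and $[a,b]=\{a,a+1,\dots,b\}$. A permutation $\sigma$ contains $\pi$ if some (not necessarily contiguous) subsequence of $\sigma$ is order isomorphic to $\pi$; otherwise it avoids $\pi$. $\mathfrak S_k(\Pi)$ is the set of $\sigma\in\mathfrak S_k$ avoiding every $\pi\in\Pi$. $\mathrm{SYT}(n)$ is the set of standard Young tableaux with $n$ boxes. $P(\pi)$ is the insertion tableau of $\pi$ under the Robinson–Schensted correspondence, and $K(S)=\{\pi\mid P(\pi)=S\}$ is the Knuth class of $S$. A set $\Pi$ of permutations is pattern-Knuth closed if $\mathfrak S_k(\Pi)$ is a union of Knuth classes for all $k$. A swap in $\pi\in\mathfrak S_n$ is the operation of interchanging adjacent elements $\pi_i,\pi_{i+1}$ where $|\pi_i-\pi_{i+1}|>1$. A set of permutations is swap closed if it is closed under swaps. For $J\subseteq[n-1]$, $D_J=\{\pi\in\mathfrak S_n\mid \mathrm{Des}(\pi)=J\}$, where $\mathrm{Des}(\pi)=\{i\mid\pi_i>\pi_{i+1}\}$, and $D_J^{-1}=\{\pi^{-1}\mid\pi\in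 D_J\}$. A standard tableau of shape $\lambda$ is row superstandard if its first row is $1,\dots,\lambda_1$, its second row is $\lambda_1+1,\dots,\lambda_1+\lambda_2$, and so on; column superstandard is defined analogously using columns. Superstandard means row or column superstandard. A superstandard hook is a superstandard tableau of hook shape $(a,1^b)$ ($a\geq 1$, $b\ge 0$; single rows and columns are included). *)

(* Defs.v *)
From mathcomp Require Import all_boot all_fingroup all_algebra.

Set Implicit Arguments.
Unset Strict Implicit.
Unset Printing Implicit Defensive.

(* The permutation pi_1 ... pi_n of [n] is s : 'S_n with
   pi_(i+1) = (s i).+1, i.e. positions and values are shifted down by one;
   [word s] is the one-line notation with the values 1, ..., n. *)
Definition word n (s : 'S_n) : seq nat := [seq (s i).+1 | i <- enum 'I_n].

(* Tableaux in English notation, given by the list of their rows. *)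
Definition tableau := seq (seq nat).

(* The list of columns of t, when the row lengths are weakly decreasing. *)
Definition transpose (t : tableau) : tableau :=
  [seq [seq nth 0 r j | r <- t & j < size r] | j <- iota 0 (size (head [::] t))].

Definition is_SYT n (t : tableau) : bool :=
  [&& [::] \notin t, sorted geq (shape t),
      all (sorted ltn) t, all (sorted ltn) (transpose t)
    & perm_eq (flatten t) (iota 1 n)].

(* Insert x in a row; also returns the bumped entry, if any. *)
Fixpoint row_insert (x : nat) (r : seq nat) : option nat * seq nat :=
  if r is y :: r' then
    if x < y then (Some y, x :: r')
    else let: (b, r'') := row_insert x r' in (b, y :: r'')
  else (None, [:: x]).

Fixpoint tab_insert (x : nat) (t : tableau) : tableau :=
  if t is r :: t' then
    match row_insert x r with
    | (None, r') => r' :: t'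
    | (Some y, r') => r' :: tab_insert y t'
    end
  else [:: [:: x]].

Definition insertion_tableau (w : seq nat) : tableau :=
  foldl (fun t x => tab_insert x t) [::] w.

Definition P n (s : 'S_n) : tableau := insertion_tableau (word s).

Definition knuth_class n (S : tableau) : {set 'S_n} := [set s | P s == S].

Definition contains k n (sigma : 'S_k) (pi : 'S_n) : bool :=
  [exists f : {ffun 'I_n -> 'I_k},
    [forall i : 'I_n, forall j : 'I_n,
      ((i < j) ==> (f i < f j)) &&
      ((sigma (f i) < sigma (f j)) == (pi i < pi j))]].

Definition avoiders n (Pi : {set 'S_n}) k : {set 'S_k} :=
  [set sigma | [forall pi in Pi, ~~ contains sigma pi]].

Definition pattern_knuth_closed n (Pi : {set 'S_n}) : Prop :=
  forall k, exists2 Ts : seq tableau,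
    all (is_SYT k) Ts & avoiders Pi k = \bigcup_(T <- Ts) knuth_class k T.

(* Products of permutations compose from left to right, so tperm i j * s
   interchanges the entries of s at the positions i and j. *)
Definition swap_closed n (Pi : {set 'S_n}) : Prop :=
  forall (s : 'S_n) (i j : 'I_n), s \in Pi -> j = i.+1 :> nat ->
    1 < `|s i - s j| -> (tperm i j * s)%g \in Pi.

(* A subset of [n-1] is represented by a set of ordinals i : 'I_n with i > 0,
   without shift.  Since positions in s are shifted, pi_i > pi_(i+1) compares
   the values of s at i-1 and i. *)
Definition Des n (s : 'S_n) : {set 'I_n} :=
  [set i : 'I_n | [exists j : 'I_n, (j.+1 == i :> nat) && (s i < s j)]].

Definition D n (J : {set 'I_n}) : {set 'S_n} := [set s | Des s == J].

Definition Dinv n (J : {set 'I_n}) : {set 'S_n} := [set (s^-1)%g | s in D J].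

Definition itv n (a b : nat) : {set 'I_n} := [set i : 'I_n | a <= i <= b].

Definition row_superstandard (t : tableau) : Prop :=
  t = reshape (shape t) (iota 1 (sumn (shape t))).

Definition column_superstandard (t : tableau) : Prop :=
  row_superstandard (transpose t).

Definition superstandard (t : tableau) : Prop :=
  row_superstandard t \/ column_superstandard t.

Definition hook_shaped (t : tableau) : Prop :=
  exists a b, 0 < a /\ shape t = a :: nseq b 1.

Definition superstandard_hook (t : tableau) : Prop :=
  superstandard t /\ hook_shaped t.

(* Main.v *)
Require Import Defs.
From mathcomp Require Import all_boot all_fingroup all_algebra.
From mathcomp Require Import all_order zify.

(** The inverse descent set of a permutation (the values that stand after
    their successor) is a Knuth invariant, so a Knuth class lies in a single
    class [Dinv J]; the theorem singles out the Knuth classes for which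
    equality holds.

    Two permutations have the same insertion tableau if and only if their
    words are connected by elementary Knuth relations ([knuthP]). Call a word
    a V-word if each letter after the leading one is a new maximum or a new
    minimum. The permutations in [Dinv (itv n 1 k)] are the V-words with [k]
    letters below the leading one ([vperm_Dinv]), and inserting a V-word
    builds a column superstandard hook ([insertion_vword]). A final interval
    [J] corresponds to reversed V-words, and reversal respects Knuth
    equivalence, which gives the row superstandard hooks. This is the
    equivalence of (iii) and (iv). Containing a V-word of a given type is a
    Knuth invariant ([knuth_has_vword]): when a Knuth relation on x < y < z
    exchanges two letters x, z of the V-word, either they lie on different
    arms of the V, and the order does not matter, or the intermediate letter y
    can replace one of them. Hence (iii) implies (i). That (iii) implies (ii)
    is immediate, since swaps exchange values that are not consecutive.

    Conversely, under (i) or (ii) the class contains a layered permutation,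
    that is, one in which each descent is by exactly one. It is the element
    whose inverse is lexicographically smallest. Under (ii) this
    holds because a swap at a larger descent makes the inverse smaller. Under
    (i), a larger descent [c a] is turned around by inserting a letter
    slightly above [a] in front of it and applying a Knuth relation; the
    result must contain an element of the class, which is obtained by deleting
    a letter, and comparing inverse descent sets shows that this element has a
    smaller inverse, whichever letter is deleted ([closed_unit_descents]).
    By reversal, the class also contains a permutation in which each ascent is
    by exactly one. The two have increasing subsequences of the same maximal
    length. In the first, the values standing before their successors form
    an increasing subsequence when the largest value is added; in the second,
    an increasing subsequence cannot leave an interval of such values. So
    these values form an interval ([ascents_interval]), and by reversal so do
    the inverse descents. Hence the inverse descent set is an initial or a
    final interval, and [S] is a superstandard hook. *)

Set Implicit Arguments.
Unset Strict Implicit.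
Unset Printing Implicit Defensive.

(** * Knuth equivalence and row insertion *)

(** Weak inequalities keep these relations valid for words with repeated
    letters, so that row insertion can be treated without distinctness. *)
Inductive knuth_relation : seq nat -> seq nat -> Prop :=
| Knuth_xzy x y z of x <= y < z : knuth_relation [:: x; z; y] [:: z; x; y]
| Knuth_zxy x y z of x <= y < z : knuth_relation [:: z; x; y] [:: x; z; y]
| Knuth_yxz x y z of x < y <= z : knuth_relation [:: y; x; z] [:: y; z; x]
| Knuth_yzx x y z of x < y <= z : knuth_relation [:: y; z; x] [:: y; x; z].

Inductive knuth : seq nat -> seq nat -> Prop :=
| knuth_refl w : knuth w w
| knuth_step u v t t' w of knuth_relation t t' & knuth (u ++ t' ++ v) w :
    knuth (u ++ t ++ v) w.

Lemma knuth_relation_sym t t' : knuth_relation t t' -> knuth_relation t' t.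
Proof. by case=> *; constructor. Qed.

Lemma knuth_relation_perm t t' : knuth_relation t t' -> perm_eq t t'.
Proof.
by case=> x y z _; apply/seq.permP=> a /=; lia.
Qed.

Lemma knuth_one u v t t' : knuth_relation t t' -> knuth (u ++ t ++ v) (u ++ t' ++ v).
Proof. by move=> /knuth_step; apply; apply: knuth_refl. Qed.

Lemma knuth_trans w2 w1 w3 : knuth w1 w2 -> knuth w2 w3 -> knuth w1 w3.
Proof. by elim=> // u v t t' w tt' _ IH /IH; apply: knuth_step. Qed.

Lemma knuth_sym w w' : knuth w w' -> knuth w' w.
Proof.
elim=> [? | u v t t' {}w tt' _ IH]; first exact: knuth_refl.
by apply: knuth_trans IH _; apply/knuth_one/knuth_relation_sym.
Qed.

Lemma knuth_catl u w w' : knuth w w' -> knuth (u ++ w) (u ++ w').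
Proof.
elim=> [? | a b t t' {}w tt' _ IH]; first exact: knuth_refl.
by rewrite catA; apply: knuth_step tt' _; rewrite -catA.
Qed.

Lemma knuth_catr u w w' : knuth w w' -> knuth (w ++ u) (w' ++ u).
Proof.
elim=> [? | a b t t' {}w tt' _ IH]; first exact: knuth_refl.
by rewrite -!catA; apply: knuth_step tt' _; rewrite !catA in IH *.
Qed.

Lemma knuth_perm w w' : knuth w w' -> perm_eq w w'.
Proof.
elim=> // u v t t' {}w /knuth_relation_perm tt' _; apply: perm_trans.
by rewrite perm_cat2l perm_cat2r.
Qed.

(** Reversal interchanges the two kinds of relations, but it leaves the weak
    inequality on the wrong side; distinct letters make all inequalities
    strict. *)
Lemma knuth_rev w w' : uniq w -> knuth w w' -> knuth (rev w) (rev w').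
Proof.
move=> Uw ww'; elim: ww' Uw => [*| u v t t' {}w tt' _ IH Uw].
  exact: knuth_refl.
have Uw' : uniq (u ++ t' ++ v).
  by rewrite -(perm_uniq (s1 := u ++ t ++ v)) // perm_cat2l perm_cat2r
             knuth_relation_perm.
have Ut : uniq t by move: Uw; rewrite !cat_uniq => /and3P[_ _ /and3P[]].
apply: knuth_trans (IH Uw').
rewrite !rev_cat -!catA; apply: knuth_one.
by case: {IH Uw Uw'} tt' Ut => x y z lt /=; rewrite !inE => Ut;
   constructor; lia.
Qed.

(** The first component is the word of bumped entries: inserting a word into
    a tableau means inserting it into the first row and the bumped word into
    the remaining rows ([insert_word_cons]). *)
Fixpoint row_insert_word (w r : seq nat) : seq nat * seq nat :=
  if w is x :: w' then
    let: (b, r1) := row_insert x r in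
    let: (bs, r2) := row_insert_word w' r1 in
    (if b is Some y then y :: bs else bs, r2)
  else ([::], r).

Definition insert_word (w : seq nat) (t : tableau) : tableau :=
  foldl (fun t x => tab_insert x t) t w.

Lemma insert_word_cat w w' t :
  insert_word (w ++ w') t = insert_word w' (insert_word w t).
Proof. exact: foldl_cat. Qed.

Lemma insert_word_cons w r t :
  insert_word w (r :: t) =
    (row_insert_word w r).2 :: insert_word (row_insert_word w r).1 t.
Proof.
elim: w r t => //= x w IH r t.
case: (row_insert x r) => [[y|] r1]; rewrite IH;
  by case: (row_insert_word w r1).
Qed.

Lemma row_insert_word_cons x w r :
  row_insert_word (x :: w) r =
    (oapp (cons^~ (row_insert_word w (row_insert x r).2).1)
          (row_insert_word w (row_insert x r).2).1 (row_insert x r).1,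
     (row_insert_word w (row_insert x r).2).2).
Proof. by rewrite /=; case: row_insert => [[y|] r1] /=; case: row_insert_word. Qed.

Lemma row_insert_ge h r x : h <= x ->
  row_insert x (h :: r) = ((row_insert x r).1, h :: (row_insert x r).2).
Proof. by rewrite /= ltnNge => -> /=; case: row_insert. Qed.

Lemma row_insert_lt h r x : x < h -> row_insert x (h :: r) = (Some h, x :: r).
Proof. by rewrite /= => ->. Qed.

Lemma row_insert_word_ge h r w : all (leq h) w ->
  row_insert_word w (h :: r) = ((row_insert_word w r).1, h :: (row_insert_word w r).2).
Proof.
elim: w r => //= x w IH r /andP[hx hw].
rewrite ltnNge hx /=; case: (row_insert x r) => b r1 /=.
by rewrite IH //; case: (row_insert_word w r1).
Qed.

Lemma bumped_gt x r y r' : row_insert x r = (Some y, r') -> x < y /\ y \in r.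
Proof.
elim: r r' => //= h r IH r'; case: ltnP => [xh [<- _] | hx].
  by rewrite mem_head.
case E: (row_insert x r) => [b r1] [eb _]; move: E; rewrite eb => /IH[-> yr].
by rewrite inE yr orbT.
Qed.

(** After [z] the smaller [y] is inserted weakly to the left of [z], so that it
    always bumps something. *)
Lemma bump_after y z r : sorted leq r -> y < z ->
  exists2 c, (row_insert y (row_insert z r).2).1 = Some c &
    c <= z /\ (c \in z :: r).
Proof.
elim: r => [|h r IH] /=; first by move=> _ ->; exists z; rewrite ?mem_head.
move=> sr yz; case: ltnP => [zh|hz] /=.
  by rewrite yz; exists z; rewrite ?mem_head.
have [c] := IH (path_sorted sr) yz.
case: (row_insert z r) => [b r'] /=; case: ltnP => [yh _ _|hy].
  by exists h; rewrite // !inE eqxx orbT.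
case: (row_insert y r') => _ r2 /= -> [cz cr]; exists c => //.
by rewrite !inE in cr *; case/orP: cr => ->; rewrite ?orbT.
Qed.

(** After [y] the larger [z] is inserted strictly to the right of [y]; if [z]
    bumps an entry then so did [y], and a weakly smaller one. *)
Lemma bump_before y z r c : sorted leq r -> y <= z ->
  (row_insert z (row_insert y r).2).1 = Some c ->
  exists2 d, (row_insert y r).1 = Some d & d <= c /\ c \in r.
Proof.
elim: r => [|h r IH] /=; first by move=> _; rewrite ltnNge => ->.
move=> sr yz; case: ltnP => [yh|hy] /=.
  rewrite ltnNge yz /=; case E: (row_insert z r) => [b r'] /= eb.
  move: E; rewrite eb => /bumped_gt[_ cr]; exists h => //; rewrite inE cr orbT.
  by split=> //; move: sr => /(order_path_min leq_trans)/allP; apply.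
have := IH (path_sorted sr) yz.
case: (row_insert y r) => [b' r'] /=.
rewrite ltnNge (leq_trans hy yz) /=.
case: (row_insert z r') => [b2 r3] /= H /H [d -> [dc cr]].
by exists d; rewrite // inE cr orbT.
Qed.

Lemma row_insert_sorted x r : sorted leq r -> sorted leq (row_insert x r).2.
Proof.
elim: r => //= h r IH sr; case: ltnP => [xh|hx] /=.
  apply: path_le (ltnW xh) sr; exact: leq_trans.
have := IH (path_sorted sr).
case: r {IH} sr => [_ _|k r]; first by rewrite /= hx.
move=> /= /andP[hk _]; case: (x < k) => //=; first by rewrite hx.
by case: row_insert => /= ? ?; rewrite hk.
Qed.

(** The two words leave the same row behind, and the words that they bump are
    again related: this is what makes the induction on the rows work. *)
Definition same_row_insertion t t' r :=
  (row_insert_word t r).2 = (row_insert_word t' r).2 /\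
  ((row_insert_word t r).1 = (row_insert_word t' r).1 \/
   knuth_relation (row_insert_word t r).1 (row_insert_word t' r).1).

Section RowRelations.

#[local] Arguments row_insert : simpl never.
#[local] Arguments row_insert_word : simpl never.

Let row_insert0 x : row_insert x [::] = (None, [:: x]).
Proof. by []. Qed.

(** By induction on the row: entries at most [x] are passed by all three
    letters, so the head [h] may be taken larger than [x]. If [z < h], the
    letters only act on [h] and the entry after it; otherwise [x] bumps [h]
    independently of the two other letters. *)
Lemma row_xzy r x y z : sorted leq r -> x <= y < z ->
  same_row_insertion [:: x; z; y] [:: z; x; y] r.
Proof.
rewrite /same_row_insertion.
elim: r => [|h r IH] sr /andP[xy yz].
  have [xz xz'] : x < z /\ x <= z by lia.
  rewrite !row_insert_word_cons !row_insert0 /= (row_insert_ge _ xz').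
  rewrite (row_insert_lt _ xz) !row_insert0 /= !(row_insert_ge _ xy).
  by rewrite (row_insert_lt _ yz) !row_insert0 /=; auto.
have hr : all (leq h) r by apply: order_path_min sr; apply: leq_trans.
have {}sr := path_sorted sr; have xz := leq_ltn_trans xy yz.
have xz' := ltnW xz.
have [hx|xh] := leqP h x.
  rewrite !row_insert_word_ge /=; try lia.
  by have [|-> ?] := IH sr _; first lia.
have [zh|hz] := ltnP z h.
  rewrite !row_insert_word_cons (row_insert_lt _ xh) (row_insert_lt _ zh) /=.
  rewrite (row_insert_lt _ xz) !row_insert_ge //=.
  case: r {IH sr} hr => [_|k r /= /andP[hk _]] /=.
    by rewrite /= (row_insert_lt _ yz); auto.
  rewrite (@row_insert_lt k) ?(@row_insert_lt z) ?(@row_insert_lt k) //=; try lia.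
  by split=> //; right; apply: Knuth_yzx; lia.
rewrite !row_insert_word_cons (row_insert_lt _ xh) !(row_insert_ge _ hz) /=.
rewrite (row_insert_lt _ xh) !row_insert_ge //=; split=> //.
have [c Ec [cz cr]] := bump_after sr yz.
rewrite Ec /=; case E: (row_insert z r).1 => [b|] /=; last by left.
have [zb br] : z < b /\ b \in r.
  by apply: (@bumped_gt _ _ _ (row_insert z r).2); rewrite -E; case: row_insert.
right; apply: Knuth_xzy; apply/andP; split; last lia.
by move: cr; rewrite inE => /orP[/eqP->|/(allP hr)].
Qed.

Lemma row_yxz r x y z : sorted leq r -> x < y <= z ->
  same_row_insertion [:: y; x; z] [:: y; z; x] r.
Proof.
rewrite /same_row_insertion.
elim: r => [|h r IH] sr /andP[xy yz].
  have xz : x <= z by lia.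
  rewrite !row_insert_word_cons !row_insert0 /= (row_insert_ge _ yz).
  rewrite (row_insert_lt _ xy) !row_insert0 /= (row_insert_ge _ xz).
  by rewrite /= (row_insert_lt _ xy); auto.
have hr : all (leq h) r by apply: order_path_min sr; apply: leq_trans.
have {}sr := path_sorted sr; have xz := leq_trans (ltnW xy) yz.
have [hx|xh] := leqP h x.
  rewrite !row_insert_word_ge /=; try lia.
  by have [|-> ?] := IH sr _; first lia.
have [yh|hy] := ltnP y h.
  rewrite !row_insert_word_cons (row_insert_lt _ yh) /=.
  rewrite (row_insert_lt _ xy) (row_insert_ge _ yz) /= (row_insert_ge _ xz) (row_insert_lt _ xy).
  split=> //=; case E: (row_insert z r).1 => [b|] /=; last by left.
  have [zb br] : z < b /\ b \in r.
    by apply: (@bumped_gt _ _ _ (row_insert z r).2); rewrite -E; case: row_insert.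
  by right; apply: Knuth_yxz; rewrite yh (allP hr).
rewrite !row_insert_word_cons (row_insert_ge _ hy) /= (row_insert_lt _ xh) /=.
rewrite !(row_insert_ge _ (leq_trans hy yz)) (row_insert_ge _ xz) /= (row_insert_lt _ xh) /=.
split=> //; case E: (row_insert z _).1 => [c|] /=; last by left.
have [d Ed [dc cr]] := bump_before sr yz E.
have [yd dr] : y < d /\ d \in r.
  by apply: (@bumped_gt _ _ _ (row_insert y r).2); rewrite -Ed; case: row_insert.
by rewrite Ed /=; right; apply: Knuth_yxz; rewrite dc andbT; lia.
Qed.

End RowRelations.

Lemma same_row_insertion_sym t t' r :
  same_row_insertion t t' r -> same_row_insertion t' t r.
Proof. by case=> e [e'|/knuth_relation_sym k]; (split; [by rewrite e|]); [left | right]. Qed.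

Lemma knuth_relation_row r t t' : sorted leq r -> knuth_relation t t' -> same_row_insertion t t' r.
Proof.
move=> sr [] x y z lt; [ | apply: same_row_insertion_sym | 
  | apply: same_row_insertion_sym]; by [apply: row_xzy | apply: row_yxz].
Qed.

Lemma knuth_relation_tab t t' T : all (sorted leq) T -> knuth_relation t t' ->
  insert_word t T = insert_word t' T.
Proof.
elim: T t t' => [|r T IH] t t'.
  have base x y z : x <= y < z ->
      insert_word [:: x; z; y] [::] = insert_word [:: z; x; y] [::].
    move=> lt /=.
    have e : (z < x = false) * (y < x = false) * (x < z) * (y < z).
      by do !split; lia.
    by do 3! rewrite ?e /=.
  have base' x y z : x < y <= z ->
      insert_word [:: y; x; z] [::] = insert_word [:: y; z; x] [::].
    move=> lt /=.
    have e : (z < x = false) * (z < y = false) * (x < y) by do !split; lia.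
    by do 3! rewrite ?e /=.
  by move=> _ [] x y z lt; rewrite ?(base x y z) ?(base' x y z).
move=> /= /andP[sr sT] tt'; rewrite !insert_word_cons.
by have [-> [->//|/(IH _ _ sT) ->]] := knuth_relation_row sr tt'.
Qed.

Lemma tab_insert_rows x T : all (sorted leq) T -> all (sorted leq) (tab_insert x T).
Proof.
elim: T x => //= r T IH x /andP[sr sT].
have := row_insert_sorted x sr.
by case: row_insert => [[y|] r'] /= ->; rewrite ?IH.
Qed.

Lemma insert_word_rows w T : all (sorted leq) T -> all (sorted leq) (insert_word w T).
Proof. by elim: w T => //= x w IH T sT; apply/IH/tab_insert_rows. Qed.

Lemma knuth_tab w w' T : all (sorted leq) T -> knuth w w' ->
  insert_word w T = insert_word w' T.
Proof.
move=> sT; elim=> // u v t t' {}w tt' _ <-.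
by rewrite !insert_word_cat (knuth_relation_tab _ tt') ?insert_word_rows.
Qed.

Definition reading_word (T : tableau) := flatten (rev T).

Lemma reading_word_cons r T : reading_word (r :: T) = reading_word T ++ r.
Proof. by rewrite /reading_word rev_cons flatten_rcons. Qed.

(** Commute [x] to the left through the sorted row, one entry at a time, with
    its left neighbour as the middle letter of a Knuth relation. *)
Lemma knuth_bump_head h r x : sorted leq (h :: r) -> x < h ->
  knuth (h :: rcons r x) (h :: x :: r).
Proof.
elim: r h => [|k r IH] h /=; first by move=> *; apply: knuth_refl.
move=> /andP[hk sr] xh.
have := knuth_catl [:: h] (IH k sr (leq_trans xh hk)) => /knuth_trans; apply.
apply: (@knuth_one [::] r [:: h; k; x] [:: h; x; k]).
by apply: Knuth_yzx; rewrite xh.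
Qed.

(** The bumped entry [y] travels to the left end of the row: next to it there
    is always a pair [h], [k] with [h <= k < y]. *)
Lemma knuth_row_insert r x y r' : sorted leq r ->
  row_insert x r = (Some y, r') -> knuth (rcons r x) (y :: r').
Proof.
elim: r r' => //= h r IH r' sr; case: ltnP => [xh [<- <-] | hx].
  exact: knuth_bump_head.
case E: (row_insert x r) => [b r1] [eb <-]; rewrite eb in E.
have := knuth_catl [:: h] (IH _ (path_sorted sr) E) => /knuth_trans; apply.
have [xy _] := bumped_gt E.
have [k [r2 [-> hk kx]]] : exists k r2, [/\ r1 = k :: r2, h <= k & k <= x].
  case: r sr E {IH} => [|k r] //= /andP[hk _].
  case: ltnP => [xk [_ <-]|kx]; first by exists x, r.
  by case: (row_insert x r) => ? r2 [_ <-]; exists k, r2.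
apply: (@knuth_one [::] r2 [:: h; y; k] [:: y; h; k]).
by apply: Knuth_xzy; lia.
Qed.

Lemma knuth_tab_insert T x : all (sorted leq) T ->
  knuth (rcons (reading_word T) x) (reading_word (tab_insert x T)).
Proof.
elim: T x => [|r T IH] x /=; first by move=> _; apply: knuth_refl.
move=> /andP[sr sT]; rewrite reading_word_cons -cats1 -catA cats1.
case E: (row_insert x r) => [[y|] r']; rewrite reading_word_cons; last first.
  suff -> : r' = rcons r x by apply: knuth_refl.
  elim: r r' E {sr} => [|h r IHr] r' /=; first by case=> <-.
  case: ltnP => // _; case E: (row_insert x r) => [b r1] [eb <-].
  by rewrite eb in E; rewrite (IHr _ E).
have := knuth_catl (reading_word T) (knuth_row_insert sr E) => /knuth_trans.
by apply; rewrite -cat_rcons; apply/knuth_catr/IH.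
Qed.

Lemma knuth_reading_word w : knuth w (reading_word (insertion_tableau w)).
Proof.
elim/last_ind: w => [|w x IH]; first exact: knuth_refl.
rewrite /insertion_tableau foldl_rcons -cats1.
apply: knuth_trans (knuth_catr _ IH) _; rewrite cats1.
exact/knuth_tab_insert/(@insert_word_rows w [::]).
Qed.

(** Every word is equivalent to the reading word of its insertion tableau, and
    insertion does not distinguish equivalent words. *)
Lemma knuthP w w' :
  knuth w w' <-> insertion_tableau w = insertion_tableau w'.
Proof.
split=> [|E]; first exact: knuth_tab.
apply: knuth_trans (knuth_reading_word w) _; rewrite E.
exact/knuth_sym/knuth_reading_word.
Qed.

(** * Insertion tableaux and standard Young tableaux *)

(** Row [r] can stand directly above row [s] in a column strict tableau. *)
Fixpoint above (r s : seq nat) : bool :=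
  match r, s with
  | _, [::] => true
  | [::], _ :: _ => false
  | x :: r', y :: s' => (x < y) && above r' s'
  end.

Lemma aboveP r s :
  reflect (size s <= size r /\ forall i, i < size s -> nth 0 r i < nth 0 s i)
          (above r s).
Proof.
elim: r s => [|x r IH] [|y s] /=; try by constructor; split.
  by constructor; case.
apply: (iffP andP) => [[xy /IH[sr H]]|[sr H]].
  by split=> // -[|i] //= /H.
by split; [apply: (H 0) | apply/IH; split=> // i; apply: (H i.+1)].
Qed.

Definition young (T : tableau) : bool :=
  [&& [::] \notin T, all (sorted leq) T & sorted above T].

Lemma above_nil r : above r [::].
Proof. by case: r. Qed.

Lemma above_row_insert x r s : above r s -> above (row_insert x r).2 s.
Proof.
elim: r s => [|h r IH] [|k s] //; rewrite ?above_nil //=.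
move=> /andP[hk rs]; case: ltnP => [xh|hx] /=; first by rewrite (ltn_trans xh hk).
by have := IH _ rs; case: row_insert => b r' /= ->; rewrite hk.
Qed.

(** A bumping path moves weakly to the left: the entry [y] lands in the next
    row at or before the column it was bumped from, because the entry below it
    was larger. *)
Lemma above_bump x r s y r' : above r s -> row_insert x r = (Some y, r') ->
  above r' (row_insert y s).2.
Proof.
elim: r s r' => [|h r IH] // s r'; rewrite /=.
case: ltnP => [xh|hx].
  case: s => [_ [<- <-]|k s /andP[hk rs] [<- <-]] /=; first by rewrite xh above_nil.
  by rewrite hk /= xh.
case E: (row_insert x r) => [b r1] rs [eb <-]; rewrite eb in E.
have [xy _] := bumped_gt E; have hy := leq_ltn_trans hx xy.
case: s rs => [_|k s /andP[hk rs]] /=; first by rewrite hy above_nil.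
case: ltnP => yk /=.
  by rewrite hy /=; have := above_row_insert x rs; rewrite E.
by have := IH _ _ rs E; case: (row_insert y s) => ? ? /=; rewrite hk.
Qed.

Lemma row_insert_nil x r : (row_insert x r).2 != [::].
Proof. by case: r => //= h r; case: ltnP => //; case: row_insert. Qed.

Lemma young_tab_insert x T : young T -> young (tab_insert x T).
Proof.
case/and3P=> T0 sT aT; apply/and3P; split; last 1 first.
- elim: T x T0 sT aT => //= r T IH x.
  rewrite inE negb_or => /andP[_ T0] /andP[_ sT] aT.
  case E: (row_insert x r) => [[y|] r'] /=; last first.
    case: T aT {IH T0 sT} => //= s T /andP[rs ->].
    by have := above_row_insert x rs; rewrite E /= => ->.
  case: T T0 sT aT IH => [_ _ _ _|s T T0 sT /= /andP[rs aT] IH] /=.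
    by have := @above_bump x r [::] y r' (above_nil r) E => /= ->.
  have := IH y T0 sT aT; have := above_bump rs E => /=.
  by case: (row_insert y s) => [[z|] s'] /= -> ->.
- elim: T x {sT aT} T0 => //= r T IH x; rewrite inE negb_or => /andP[r0 T0].
  have := row_insert_nil x r; case: row_insert => [[y|] r'] /= r'0.
    by rewrite inE negb_or eq_sym r'0 IH.
  by rewrite inE negb_or eq_sym r'0.
- exact: tab_insert_rows.
Qed.

Lemma young_insertion_tableau w : young (insertion_tableau w).
Proof.
elim/last_ind: w => // w x IH.
by rewrite /insertion_tableau foldl_rcons young_tab_insert.
Qed.

Lemma flatten_insertion_tableau w : perm_eq (flatten (insertion_tableau w)) w.
Proof.
have := knuth_perm (knuth_reading_word w); rewrite perm_sym; apply: perm_trans.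
by rewrite perm_sym; apply: perm_flatten; rewrite perm_rev.
Qed.

Definition column j (T : tableau) := [seq nth 0 r j | r <- T & j < size r].

Lemma column_nil j r T : sorted geq (shape (r :: T)) -> size r <= j ->
  column j (r :: T) = [::].
Proof.
rewrite /column => sh rj; rewrite (@eq_in_filter _ _ pred0) ?filter_pred0 // => s.
rewrite inE => /orP[/eqP->|sT]; first by rewrite ltnNge rj.
have := order_path_min (rev_trans leq_trans) sh => /allP/(_ (size s)) H.
by rewrite ltnNge (leq_trans _ rj) //; apply: H; apply: map_f.
Qed.

Lemma sorted_aboveP T : sorted geq (shape T) ->
  sorted above T <-> forall j, sorted ltn (column j T).
Proof.
elim: T => [|r T IH] // sh; have {}IH := IH (path_sorted sh).
have columnE (r0 : seq nat) T0 j : column j (r0 :: T0) =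
    if j < size r0 then nth 0 r0 j :: column j T0 else column j T0.
  by rewrite /column /=; case: ltnP.
split=> [aT j|H].
  have cT : sorted ltn (column j T) by apply: (proj1 IH); apply: path_sorted aT.
  rewrite columnE; case: ltnP => // jr.
  case: T sh aT cT {IH} => // s T /andP[_ sh] /= /andP[/aboveP[_ rs] _] cT.
  case: (ltnP j (size s)) => js; last by rewrite column_nil.
  by move: cT; rewrite columnE js /= rs.
have cT : sorted above T.
  apply/IH => j; have := H j; rewrite columnE.
  by case: ltnP => // _ /path_sorted.
case: T sh cT H {IH} => //= s T /andP[sr _] -> H; rewrite andbT.
apply/aboveP; split=> // i si.
by have := H i; rewrite !columnE si (leq_trans si sr) /= => /andP[].
Qed.

Lemma transpose_sorted T : sorted geq (shape T) ->
  all (sorted ltn) (transpose T) = sorted above T.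
Proof.
move=> sh; apply/idP/idP.
  rewrite /transpose all_map => /allP H; apply/sorted_aboveP => // j.
  case: T sh H => // r T sh H; case: (ltnP j (size r)) => jr.
    by apply: H; rewrite mem_iota.
  by rewrite column_nil.
move/(sorted_aboveP sh) => H; rewrite /transpose all_map.
by apply/allP => j _; apply: H.
Qed.

Lemma is_SYT_young n T : is_SYT n T = young T && perm_eq (flatten T) (iota 1 n).
Proof.
rewrite /is_SYT /young; case: (boolP (perm_eq _ _)) => [pT|]; last by rewrite !andbF.
rewrite !andbT; case: ([::] \notin T) => //=.
have UT : uniq (flatten T) by rewrite (perm_uniq pT) iota_uniq.
have -> : all (sorted ltn) T = all (sorted leq) T.
  elim: T UT {pT} => //= r T IH; rewrite cat_uniq => /and3P[Ur _ /IH->].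
  by rewrite ltn_sorted_uniq_leq Ur.
apply/and3P/andP => [[sh -> ?]|[sT aT]]; first by rewrite -transpose_sorted.
have sh : sorted geq (shape T).
  elim: T aT {sT pT UT} => //= r [|s T] IH //= /andP[/aboveP[sr _] /IH].
  by rewrite /= sr.
by rewrite transpose_sorted.
Qed.

(** The letters of [r], in increasing order, bump the entries of [s] from left
    to right, each one straight below its own column. *)
Lemma insert_row_above r s : sorted leq r -> above r s ->
  row_insert_word r s = (s, r).
Proof.
elim: r s => [|x r IH] [|y s] //= sr.
  move=> _; rewrite row_insert_word_ge ?(order_path_min leq_trans) //.
  by rewrite IH ?(path_sorted sr) ?above_nil.
case/andP=> xy rs; rewrite xy row_insert_word_ge ?(order_path_min leq_trans) //=.
by rewrite IH ?(path_sorted sr).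
Qed.

(** Inserting the rows from the bottom up pushes the tableau built so far down
    by one row at each stage. *)
Lemma insert_reading_word T : young T -> insertion_tableau (reading_word T) = T.
Proof.
elim: T => // r T IH /and3P[].
rewrite inE negb_or => /andP[r0 T0] /= /andP[sr sT] aT.
have {}IH := IH (introT and3P (And3 T0 sT (path_sorted aT))).
rewrite reading_word_cons /insertion_tableau foldl_cat -/(insertion_tableau _) IH.
have nil r' : r' != [::] -> sorted leq r' -> insert_word r' [::] = [:: r'].
  move=> r'0 sr'; have -> : insert_word r' [::] = insert_word r' [:: [::]].
    by case: r' r'0 {sr'}.
  by rewrite insert_word_cons insert_row_above ?above_nil.
rewrite -/(insert_word r T); elim: T r r0 T0 sr sT aT {IH} => [|s T IH] r.
  by rewrite eq_sym => *; apply: nil.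
rewrite inE negb_or => _ /andP[s0 T0] sr /= /andP[ss sT] /andP[rs aT].
by rewrite insert_word_cons insert_row_above //= IH.
Qed.

(** * Knuth classes of permutations *)

Lemma size_word n (s : 'S_n) : size (word s) = n.
Proof. by rewrite size_map size_enum_ord. Qed.

Lemma nth_word n (s : 'S_n) (i : 'I_n) : nth 0 (word s) i = (s i).+1.
Proof. by rewrite (nth_map i) ?size_enum_ord // nth_ord_enum. Qed.

Lemma word_uniq n (s : 'S_n) : uniq (word s).
Proof.
by rewrite map_inj_uniq ?enum_uniq // => i j [/val_inj/perm_inj].
Qed.

Lemma perm_word n (s : 'S_n) : perm_eq (word s) (iota 1 n).
Proof.
apply: uniq_perm; rewrite ?word_uniq ?iota_uniq //.
have : {subset word s <= iota 1 n}.
  by move=> x /mapP[i _ ->]; rewrite mem_iota; have := ltn_ord (s i); lia.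
by move/uniq_min_size => -[||_ H] //; rewrite ?word_uniq // size_word size_iota.
Qed.

Lemma word_surj n (w : seq nat) : perm_eq w (iota 1 n) -> exists s : 'S_n, word s = w.
Proof.
move=> pw; have sw : size w = n by rewrite (perm_size pw) size_iota.
have Uw : uniq w by rewrite (perm_uniq pw) iota_uniq.
have rng (i : 'I_n) : (nth 0 w i).-1 < n /\ 0 < nth 0 w i.
  have : nth 0 w i \in w by rewrite mem_nth ?sw.
  by rewrite (perm_mem pw) mem_iota; lia.
pose f i := Ordinal (proj1 (rng i)).
have finj : injective f.
  move=> i j /(congr1 val) /= E; have [_ ?] := rng i; have [_ ?] := rng j.
  apply/val_inj/eqP; rewrite -(nth_uniq 0 _ _ Uw) ?sw ?ltn_ord //.
  by rewrite -[nth 0 w i]prednK // E prednK.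
exists (perm finj); apply: (@eq_from_nth _ 0); rewrite size_word ?sw // => i ilt.
by rewrite (nth_word _ (Ordinal ilt)) permE /= prednK //; have [] := rng (Ordinal ilt).
Qed.

Lemma subseq_wordP n (s : 'S_n) u :
  reflect (exists2 v : seq 'I_n, sorted ltn (map val v) & u = [seq (s i).+1 | i <- v])
          (subseq u (word s)).
Proof.
apply: (iffP subseqP) => [[m sm ->]|[v sv ->]].
  exists (mask m (enum 'I_n)); last by rewrite map_mask.
  rewrite map_mask val_enum_ord; apply: sorted_mask; first exact: ltn_trans.
  exact: iota_ltn_sorted.
apply/subseqP/map_subseq; suff -> : v = [seq i <- enum 'I_n | i \in v].
  exact: filter_subseq.
apply: (inj_map val_inj); apply: (irr_sorted_eq ltn_trans ltnn) => //.
  apply: (subseq_sorted ltn_trans (map_subseq val (filter_subseq _ _))).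
  by rewrite val_enum_ord iota_ltn_sorted.
by apply: eq_mem_map => i; rewrite mem_filter mem_enum andbT.
Qed.

Lemma before_word n (s : 'S_n) (a b : 'I_n) :
  subseq [:: a.+1; b.+1] (word s) = (s^-1 a < s^-1 b)%g.
Proof.
apply/subseq_wordP/idP => [[[|i [|j []]] //= /andP[ij _]]|lt].
  by case=> /val_inj-> /val_inj->; rewrite !permK.
by exists [:: s^-1 a; s^-1 b]%g; rewrite /= ?andbT ?permKV.
Qed.

Lemma P_SYT n (s : 'S_n) : is_SYT n (P s).
Proof.
rewrite is_SYT_young young_insertion_tableau.
exact: perm_trans (flatten_insertion_tableau _) (perm_word s).
Qed.

Lemma knuth_class_reading n S : is_SYT n S ->
  exists2 s : 'S_n, P s = S & word s = reading_word S.
Proof.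
rewrite is_SYT_young => /andP[yS pS].
have [|s E] := @word_surj n (reading_word S).
  by apply: perm_trans pS; apply: perm_flatten; rewrite perm_rev.
by exists s => //; rewrite /P E insert_reading_word.
Qed.

Lemma knuth_P n (s s' : 'S_n) : knuth (word s) (word s') <-> P s = P s'.
Proof. exact: knuthP. Qed.

Definition reverse n (s : 'S_n) : 'S_n := (perm (@rev_ord_inj n) * s)%g.

Lemma reverseE n (s : 'S_n) i : reverse s i = s (rev_ord i).
Proof. by rewrite permM permE. Qed.

Lemma reverseK n : involutive (@reverse n).
Proof. by move=> s; apply/permP => i; rewrite !reverseE rev_ordK. Qed.

Lemma reverse_inv n (s : 'S_n) i : (reverse s)^-1%g i = rev_ord (s^-1%g i).
Proof.
by apply: (@perm_inj _ (reverse s)); rewrite permKV reverseE rev_ordK permKV.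
Qed.

Lemma word_reverse n (s : 'S_n) : word (reverse s) = rev (word s).
Proof.
apply: (@eq_from_nth _ 0); rewrite ?size_rev ?size_word // => i ilt.
rewrite nth_rev ?size_word // (nth_word _ (Ordinal ilt)) reverseE.
by rewrite -(nth_word s (rev_ord (Ordinal ilt))).
Qed.

Lemma P_reverse n (s s' : 'S_n) : P s = P s' -> P (reverse s) = P (reverse s').
Proof.
move=> /knuth_P H; apply/knuth_P; rewrite !word_reverse.
exact: knuth_rev (word_uniq s) H.
Qed.

(** The word [y z x] becomes [y x z]. *)
Lemma knuth_move n (s : 'S_n) (i j k : 'I_n) : j = i.+1 :> nat -> k = j.+1 :> nat ->
  s k < s i < s j -> P (tperm j k * s)%g = P s.
Proof.
move=> ji kj lt; apply/knuth_P/knuth_sym.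
have E (t : 'S_n) : (forall l : 'I_n, l < i \/ k < l -> t l = s l) ->
   word t = take i (word s) ++ [:: (t i).+1; (t j).+1; (t k).+1] ++ drop k.+1 (word s).
  move=> H; apply: (@eq_from_nth _ 0).
    by rewrite !size_cat size_takel ?size_drop ?size_word /=; have := ltn_ord k; lia.
  rewrite size_word => l ll; pose o : 'I_n := Ordinal ll.
  rewrite -[l]/(o : nat) nth_word; clearbody o => {l ll}.
  rewrite nth_cat size_takel ?size_word; last by have := ltn_ord i; lia.
  case: ltnP => oi; first by rewrite nth_take // nth_word H //; left.
  have [e|[e|[e|ko]]] : o = i :> nat \/ o = j :> nat \/ o = k :> nat \/ k < o by lia.
  - by rewrite (val_inj e) subnn.
  - by rewrite (val_inj e) ji subSnn.
  - by rewrite (val_inj e) kj ji (_ : i.+2 - i = 2) //; lia.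
  rewrite nth_cat /= ltnNge; have -> : 3 <= o - i by lia.
  rewrite nth_drop (_ : k.+1 + _ = o); last by lia.
  by rewrite nth_word H //; right.
rewrite (E s) // [in X in knuth _ X]E; last first.
  move=> l H; rewrite permM tpermD //; apply/eqP => e; move: H; rewrite -e; lia.
rewrite !permM tpermL tpermR tpermD; try by apply/eqP => e; move: ji kj; rewrite e; lia.
by apply: knuth_one; apply: Knuth_yzx; lia.
Qed.

Lemma knuth_relation_uniq t t' : uniq t -> knuth_relation t t' ->
  exists x y z, x < y < z /\
    [\/ t = [:: x; z; y] /\ t' = [:: z; x; y],
        t = [:: z; x; y] /\ t' = [:: x; z; y],
        t = [:: y; x; z] /\ t' = [:: y; z; x] |
        t = [:: y; z; x] /\ t' = [:: y; x; z]].
Proof.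
move=> Ut tt'; case: tt' Ut => x y z lt /=; rewrite !inE => Ut; exists x, y, z;
  (split; first lia); by [constructor 1|constructor 2|constructor 3|constructor 4].
Qed.

(** On words with distinct letters it suffices to check an invariant on a
    single Knuth relation in context. *)
Lemma knuth_invariant (I : seq nat -> Prop) w w' :
  (forall u v t t', uniq (u ++ t ++ v) -> uniq t -> knuth_relation t t' ->
     I (u ++ t ++ v) -> I (u ++ t' ++ v)) ->
  uniq w -> knuth w w' -> I w -> I w'.
Proof.
move=> H Uw ww'; elim: ww' Uw => // u v t t' {}w tt' _ IH Uw Iw.
apply: IH; last by apply: H tt' Iw => //; move: Uw; rewrite !cat_uniq => /and5P[].
by rewrite -(perm_uniq (s1 := u ++ t ++ v)) // perm_cat2l perm_cat2r knuth_relation_perm.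
Qed.

(** Whether [a] stands before [a + 1] can be read off the subword on these two
    values. A Knuth relation exchanges values that enclose a third one, so it
    never touches this subword. *)
Lemma inv_descents_P n (s s' : 'S_n) (a b : 'I_n) : b = a.+1 :> nat -> P s = P s' ->
  (s^-1 a < s^-1 b)%g = (s'^-1 a < s'^-1 b)%g.
Proof.
move=> ba /knuth_P ss'; rewrite -!before_word.
pose p := [pred c | (c == a.+1) || (c == b.+1)].
have E w : subseq [:: a.+1; b.+1] w = subseq [:: a.+1; b.+1] (filter p w).
  by rewrite subseq_filter /= !eqxx orbT.
have Hp x y z : x < y < z -> ~~ (p x && p z) by rewrite /p /=; lia.
rewrite E [RHS]E; congr subseq; clearbody p => {E}.
apply: (@knuth_invariant (fun w => filter p (word s) = filter p w) _ _ _ _ ss') => //.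
  move=> u v t t' _ Ut tt' ->; rewrite !filter_cat; congr (_ ++ (_ ++ _)).
  have [x [y [z [lt]]]] := knuth_relation_uniq Ut tt'.
  have xz := Hp _ _ _ lt.
  by case=> -[-> ->] /=; case: (p y); case: (p x) (p z) xz => [] [].
exact: word_uniq.
Qed.

(** * V-words and Knuth relations *)

(** Of two letters [s], [t] in this order, [t] may be the larger one only if it
    exceeds [m], and the smaller one only if it is below [m]. In a word that
    starts with [m] this says that every later letter is a new maximum or a
    new minimum. *)
Definition vrel (m s t : nat) : bool :=
  ((s < t) ==> (m < t)) && ((t < s) ==> (t < m)).

(** Plotted by value, the positions in such a word form a V: the [p] letters
    below [m] come in decreasing order, the [q] letters above [m] in increasing
    order, and [m] stands at the left end. *)
Definition vword (m p q : nat) (u : seq nat) : Prop :=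
  [/\ ohead u = Some m, pairwise (vrel m) u,
      count (ltn^~ m) u = p & count (ltn m) u = q].

Definition has_vword (p q : nat) (w : seq nat) : Prop :=
  exists m u, subseq u w /\ vword m p q u.

Lemma subseq_cat_split (T : eqType) (u a b : seq T) : subseq u (a ++ b) ->
  exists u1 u2, [/\ u = u1 ++ u2, subseq u1 a & subseq u2 b].
Proof.
case/subseqP => m sm ->; exists (mask (take (size a) m) a), (mask (drop (size a) m) b).
rewrite -mask_cat ?cat_take_drop ?mask_subseq //.
by rewrite size_takel // sm size_cat leq_addr.
Qed.

Lemma pairwise_replace (r r' : rel nat) s1 s2 s2' s3 :
  {in s1 ++ s3 &, forall s t, r s t -> r' s t} ->
  {in s1, forall s, all (r s) s2 -> all (r' s) s2'} ->
  {in s3, forall t, all (r^~ t) s2 -> all (r'^~ t) s2'} ->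
  pairwise r' s2' ->
  pairwise r (s1 ++ s2 ++ s3) -> pairwise r' (s1 ++ s2' ++ s3).
Proof.
move=> H H1 H3 p2; rewrite !pairwise_cat !allrel_catr.
case/and5P => /andP[a12 a13] p1 a23 _ p3; rewrite p2.
have sub t : {subset t <= s1 ++ s3} -> pairwise r t -> pairwise r' t.
  move=> st; apply: sub_in_pairwise (allss t) => a b /st ? /st ?; exact: H.
rewrite (sub s1) ?(sub s3) //=; first last.
- by move=> a aS; rewrite mem_cat aS ?orbT.
- by move=> a aS; rewrite mem_cat aS ?orbT.
rewrite !andbT -andbA; apply/and3P; split.
- by apply/allP => s ss; apply: H1 => //; apply: (allP a12).
- apply/allrelP => s t ss ts; apply: H; rewrite ?mem_cat ?ss ?ts ?orbT //.
  exact: (allrelP a13).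
rewrite allrelC; apply/allP => t ts; apply: H3 => //.
by move: a23; rewrite allrelC => /allP; apply.
Qed.

(** Reordering a factor does not affect the counts, so only the order inside
    the factor has to be checked. *)
Lemma vword_keep m p q s1 s2 s2' s3 : 
  vword m p q (s1 ++ s2 ++ s3) ->
  (s1 = [::] -> ohead (s2' ++ s3) = Some m) ->
  perm_eq s2 s2' -> pairwise (vrel m) s2' ->
  vword m p q (s1 ++ s2' ++ s3).
Proof.
case=> hu pu cp cq h pe ps; split.
- by case: s1 hu h {pu cp cq} => //= _ ->.
- apply: pairwise_replace ps pu => //.
  + by move=> s _; rewrite (perm_all _ pe).
  + by move=> s _; rewrite (perm_all _ pe).
- by rewrite -cp !count_cat (seq.permP pe).
- by rewrite -cq !count_cat (seq.permP pe).
Qed.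

Lemma subseq3_swap12 (s : seq nat) a b c : subseq s [:: a; b; c] ->
  [\/ subseq s [:: b; a; c], s = [:: a; b] | s = [:: a; b; c]].
Proof.
case/subseqP=> -[|[] [|[] [|[] []]]] // _ ->; rewrite [mask _ _]/=;
  try by constructor.
all: constructor 1; rewrite ?sub1seq ?inE ?eqxx ?orbT //.
- exact: suffix_subseq [:: b] [:: a; c].
- exact: cat_subseq (subseq_refl [:: b]) (suffix_subseq [:: a] [:: c]).
Qed.

Lemma subseq3_swap23 (s : seq nat) a b c : subseq s [:: a; b; c] ->
  [\/ subseq s [:: a; c; b], s = [:: b; c] | s = [:: a; b; c]].
Proof.
rewrite -subseq_rev => /subseq3_swap12[H|H|H]; [constructor 1|constructor 2|constructor 3].
- by rewrite -subseq_rev.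
- by rewrite -[s]revK H.
- by rewrite -[s]revK H.
Qed.

(** Only subwords that use both exchanged letters can be destroyed. If [m]
    separates [x] and [z], their order is irrelevant. Otherwise [x] and [z] are
    consecutive in the increasing arm and [y], which keeps its place relative
    to [x], can replace [z]. *)
Lemma vword_xzy x y z m p q s1 s2 s3 : x < y < z ->
  subseq s2 [:: x; z; y] -> vword m p q (s1 ++ s2 ++ s3) ->
  exists m' s2', subseq s2' [:: z; x; y] /\ vword m' p q (s1 ++ s2' ++ s3).
Proof.
move=> lt sub V; have pv := V; case: pv => hu pu cp cq.
have p2 : pairwise (vrel m) s2 by move: pu; rewrite !pairwise_cat => /and5P[].
case/subseq3_swap12: sub => [?|e|e]; first by exists m, s2.
all: rewrite {s2}e in V p2 hu pu cp cq *; rewrite /vrel /= in p2.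
2: lia.
have [xm|mx] := ltnP x m.
  exists m, [:: z; x]; split; first exact: prefix_subseq [:: z; x] [:: y].
  apply: vword_keep V _ _ _ => /=; rewrite /vrel; try lia.
    by move=> s0; move: hu; rewrite s0 => -[]; lia.
  by apply/seq.permP => a /=; lia.
exists m, [:: x; y]; split; first exact: suffix_subseq [:: z] _.
split.
- by case: s1 hu {V pu cp cq}.
- by apply: pairwise_replace pu => [s t|s _|t _|] //=; rewrite /vrel; lia.
- by rewrite -cp !count_cat /=; lia.
- by rewrite -cq !count_cat /=; lia.
Qed.

(** Mirror image of [vword_xzy] in the decreasing arm: [y] replaces [x]. *)
Lemma vword_zxy x y z m p q s1 s2 s3 : x < y < z ->
  subseq s2 [:: z; x; y] -> vword m p q (s1 ++ s2 ++ s3) ->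
  exists m' s2', subseq s2' [:: x; z; y] /\ vword m' p q (s1 ++ s2' ++ s3).
Proof.
move=> lt sub V; have pv := V; case: pv => hu pu cp cq.
have p2 : pairwise (vrel m) s2 by move: pu; rewrite !pairwise_cat => /and5P[].
case/subseq3_swap12: sub => [?|e|e]; first by exists m, s2.
all: rewrite {s2}e in V p2 hu pu cp cq *; rewrite /vrel /= in p2.
2: lia.
have [mz|zm] := ltnP m z.
  exists m, [:: x; z]; split; first exact: prefix_subseq [:: x; z] [:: y].
  apply: vword_keep V _ _ _ => /=; rewrite /vrel; try lia.
    by move=> s0; move: hu; rewrite s0 => -[]; lia.
  by apply/seq.permP => a /=; lia.
exists m, [:: z; y]; split; first exact: suffix_subseq [:: x] _.
split.
- by case: s1 hu {V pu cp cq}.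
- by apply: pairwise_replace pu => [s t|s _|t _|] //=; rewrite /vrel; lia.
- by rewrite -cp !count_cat /=; lia.
- by rewrite -cq !count_cat /=; lia.
Qed.

(** As in [vword_xzy], but here [y] replaces [x]; when [x] is the corner [m] of
    the V, the corner moves to [y]. *)
Lemma vword_yxz x y z m p q s1 s2 s3 : x < y < z -> uniq (s1 ++ s2 ++ s3) ->
  subseq s2 [:: y; x; z] -> vword m p q (s1 ++ s2 ++ s3) ->
  exists m' s2', subseq s2' [:: y; z; x] /\ vword m' p q (s1 ++ s2' ++ s3).
Proof.
move=> lt Uu sub V; have pv := V; case: pv => hu pu cp cq.
have p2 : pairwise (vrel m) s2 by move: pu; rewrite !pairwise_cat => /and5P[].
case/subseq3_swap23: sub => [?|e|e]; first by exists m, s2.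
all: rewrite {s2}e in V p2 hu pu cp cq Uu *; rewrite /vrel /= in p2.
  have [xm|mx] := ltnP x m.
    exists m, [:: z; x]; split; first exact: suffix_subseq [:: y] _.
    apply: vword_keep V _ _ _ => /=; rewrite /vrel; try lia.
      by move=> s0; move: hu; rewrite s0 => -[]; lia.
    by apply/seq.permP => a /=; lia.
  case: s1 hu pu cp cq Uu {V} => [|h s1] hu pu cp cq Uu.
    have mE : m = x by case: hu.
    have s3P t : t \in s3 -> t < x \/ z <= t.
      move: pu; rewrite mE /= => /andP[_ /andP[/allP H _]] /H.
      by rewrite /vrel; lia.
    exists y, [:: y; z]; split; first exact: prefix_subseq [:: y; z] [:: x].
    split=> //.
    + apply: pairwise_replace pu => [s t /s3P Hs /s3P Ht|//|t /s3P Ht|] /=;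
        rewrite /vrel; lia.
    + rewrite -cp mE /= !ltnn; congr (_ + (_ + _)); first by lia.
      by apply: eq_in_count => t /s3P /= Ht; lia.
    + rewrite -cq mE /= !ltnn; congr (_ + (_ + _)); first by lia.
      by apply: eq_in_count => t /s3P /= Ht; lia.
  have xm : x != m.
    move: Uu; case: hu => <- /= /andP[+ _]; apply: contra => /eqP <-.
    by rewrite !(mem_cat, inE) eqxx !orbT.
  exists m, [:: y; z]; split; first exact: prefix_subseq [:: y; z] [:: x].
  split.
  - by [].
  - by apply: pairwise_replace pu => [s t|s _|t _|] //=; rewrite /vrel; lia.
  - by rewrite -cp !count_cat /=; lia.
  - by rewrite -cq !count_cat /=; lia.
exists m, [:: y; z; x]; split => //.
apply: vword_keep V _ _ _ => /=; rewrite /vrel; try lia.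
  by move=> s0; move: hu; rewrite s0.
by apply/seq.permP => a /=; lia.
Qed.

(** As in [vword_zxy], but here [y] replaces [z]; when [z] is the corner [m] of
    the V, the corner moves to [y]. *)
Lemma vword_yzx x y z m p q s1 s2 s3 : x < y < z -> uniq (s1 ++ s2 ++ s3) ->
  subseq s2 [:: y; z; x] -> vword m p q (s1 ++ s2 ++ s3) ->
  exists m' s2', subseq s2' [:: y; x; z] /\ vword m' p q (s1 ++ s2' ++ s3).
Proof.
move=> lt Uu sub V; have pv := V; case: pv => hu pu cp cq.
have p2 : pairwise (vrel m) s2 by move: pu; rewrite !pairwise_cat => /and5P[].
case/subseq3_swap23: sub => [?|e|e]; first by exists m, s2.
all: rewrite {s2}e in V p2 hu pu cp cq Uu *; rewrite /vrel /= in p2.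
  have [mz|zm] := ltnP m z.
    exists m, [:: x; z]; split; first exact: suffix_subseq [:: y] _.
    apply: vword_keep V _ _ _ => /=; rewrite /vrel; try lia.
      by move=> s0; move: hu; rewrite s0 => -[]; lia.
    by apply/seq.permP => a /=; lia.
  case: s1 hu pu cp cq Uu {V} => [|h s1] hu pu cp cq Uu.
    have mE : m = z by case: hu.
    have s3P t : t \in s3 -> t <= x \/ z < t.
      move: pu; rewrite mE /= => /andP[_ /andP[/allP H _]] /H.
      by rewrite /vrel; lia.
    exists y, [:: y; x]; split; first exact: prefix_subseq [:: y; x] [:: z].
    split=> //.
    + apply: pairwise_replace pu => [s t /s3P Hs /s3P Ht|//|t /s3P Ht|] /=;
        rewrite /vrel; lia.
    + rewrite -cp mE /= !ltnn; congr (_ + (_ + _)); first by lia.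
      by apply: eq_in_count => t /s3P /= Ht; lia.
    + rewrite -cq mE /= !ltnn; congr (_ + (_ + _)); first by lia.
      by apply: eq_in_count => t /s3P /= Ht; lia.
  have zm' : z != m.
    move: Uu; case: hu => <- /= /andP[+ _]; apply: contra => /eqP <-.
    by rewrite !(mem_cat, inE) eqxx !orbT.
  exists m, [:: y; x]; split; first exact: prefix_subseq [:: y; x] [:: z].
  split.
  - by [].
  - by apply: pairwise_replace pu => [s t|s _|t _|] //=; rewrite /vrel; lia.
  - by rewrite -cp !count_cat /=; lia.
  - by rewrite -cq !count_cat /=; lia.
exists m, [:: y; x; z]; split => //.
apply: vword_keep V _ _ _ => /=; rewrite /vrel; try lia.
  by move=> s0; move: hu; rewrite s0.
by apply/seq.permP => a /=; lia.
Qed.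

Lemma knuth_has_vword p q w w' : uniq w -> knuth w w' ->
  has_vword p q w -> has_vword p q w'.
Proof.
apply: knuth_invariant => u v t t' Uw Ut tt' [m [s [sub V]]].
have [s1 [s23 [es sub1 sub23]]] := subseq_cat_split sub.
have [s2 [s3 [es' sub2 sub3]]] := subseq_cat_split sub23.
have Us := subseq_uniq sub Uw; rewrite {}es {}es' in V Us.
have [x [y [z [lt cases]]]] := knuth_relation_uniq Ut tt'.
suff [m' [s2' [sub2' V']]] :
    exists m' s2', subseq s2' t' /\ vword m' p q (s1 ++ s2' ++ s3).
  by exists m', (s1 ++ s2' ++ s3); split; rewrite // !cat_subseq.
case: cases => -[? ?]; subst t t'.
- exact: vword_xzy V.
- exact: vword_zxy V.
- exact: vword_yxz V.
- exact: vword_yzx V.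
Qed.

Lemma P_has_vword p q n (s s' : 'S_n) : P s = P s' ->
  has_vword p q (word s) -> has_vword p q (word s').
Proof. by move/knuth_P; apply: knuth_has_vword; apply: word_uniq. Qed.

(** * Patterns in inverse descent classes *)

Lemma DinvE n (J : {set 'I_n}) (s : 'S_n) : (s \in Dinv J) = (Des s^-1 == J)%g.
Proof.
apply/imsetP/idP => [[t]|H]; first by rewrite inE => tJ ->; rewrite invgK.
by exists s^-1%g; rewrite ?inE ?invgK.
Qed.

Lemma mem_Des n (t : 'S_n) (i j : 'I_n) : j = i.+1 :> nat ->
  (j \in Des t) = (t j < t i).
Proof.
move=> ji; rewrite inE; apply/existsP/idP => [[i' /andP[/eqP e lt]]|lt].
  suff -> : i = i' by []. by apply: val_inj => /=; lia.
by exists i; rewrite ji eqxx.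
Qed.

Lemma Des_gt0 n (t : 'S_n) (i : 'I_n) : i \in Des t -> 0 < i.
Proof. by rewrite inE => /existsP[j /andP[/eqP <-]]. Qed.

Lemma DesP n (t : 'S_n) (J : {set 'I_n}) :
  (forall i, i \in J -> 0 < i) ->
  Des t = J <-> forall i j : 'I_n, j = i.+1 :> nat -> (t j < t i) = (j \in J).
Proof.
move=> J0; split=> [<- i j ji|H]; first by rewrite (mem_Des t ji).
apply/setP => j; case: (posnP j) => [j0|jp].
  by apply/idP/idP => [/Des_gt0|/J0]; rewrite j0.
have lt : j.-1 < n by have := ltn_ord j; lia.
have ji : j = (Ordinal lt).+1 :> nat by rewrite /= prednK.
by rewrite (mem_Des t ji) (H _ _ ji).
Qed.

(** Positions indexed by natural numbers, and shifted by one, so that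
    inductions over intervals of values avoid ordinals. *)
Definition pos n (s : 'S_n) (v : nat) := nth 0 (word s^-1) v.

Lemma posE n (s : 'S_n) (v : 'I_n) : pos s v = (s^-1%g v).+1.
Proof. exact: nth_word. Qed.

Lemma homo_interval (f : nat -> nat) a b :
  (forall v, a <= v < b -> f v < f v.+1) ->
  forall v w, a <= v -> v < w -> w <= b -> f v < f w.
Proof.
move=> H v w av; elim: w => // w IH; rewrite ltnS leq_eqVlt => /orP[/eqP<-|vw] wb.
  by apply: H; rewrite av.
by apply: ltn_trans (IH vw (ltnW wb)) (H _ _); lia.
Qed.

Lemma antihomo_interval (f : nat -> nat) a b :
  (forall v, a <= v < b -> f v.+1 < f v) ->
  forall v w, a <= v -> v < w -> w <= b -> f w < f v.
Proof.
move=> H v w av; elim: w => // w IH; rewrite ltnS leq_eqVlt => /orP[/eqP<-|vw] wb.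
  by apply: H; rewrite av.
by apply: ltn_trans (H _ _) (IH vw (ltnW wb)); lia.
Qed.

(** The V-words among the permutations, with values and corner shifted down by
    one. *)
Definition vperm n p (s : 'S_n) : Prop :=
  (forall i : 'I_n, i = 0 :> nat -> s i = p :> nat) /\
  (forall i j : 'I_n, i < j -> vrel p (s i) (s j)).

Lemma itv1_gt0 n p (i : 'I_n) : i \in itv n 1 p -> 0 < i.
Proof. by rewrite inE => /andP[]. Qed.

(** For [J = [1,p]] the values [p, ..., 0] come in this order, and so do
    [p, p + 1, ...]. Hence [p] comes before every other value, the smaller values
    come in decreasing and the larger ones in increasing order. *)
Lemma vperm_Dinv n p (s : 'S_n) : p < n -> vperm p s <-> s \in Dinv (itv n 1 p).
Proof.
move=> pn; rewrite DinvE; have J0 := @itv1_gt0 n p; split=> [[s0 sv]|/eqP].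
  apply/eqP/(DesP _ J0) => v w wv; rewrite inE wv /=.
  have [wp|pw] := ltnP v p.
    have [//|lt|/val_inj/perm_inj e] := ltngtP (s^-1 w)%g (s^-1 v)%g; last by move: wv; rewrite e; lia.
    by have := sv _ _ lt; rewrite !permKV /vrel; lia.
  apply/negP => lt.
  by have := sv _ _ lt; rewrite !permKV /vrel; lia.
move/(DesP _ J0) => H.
have desc v w : v < w -> w <= p -> pos s w < pos s v.
  move=> vw wp; apply: (@antihomo_interval (pos s) 0 p) => // u up.
  have u1 : u.+1 < n by lia. have u0 := ltnW u1.
  have := H (Ordinal u0) (Ordinal u1) (erefl _); rewrite inE /=.
  by have := posE s (Ordinal u0); have := posE s (Ordinal u1) => /= -> ->; lia.
have asc v w : p <= v -> v < w -> w < n -> pos s v < pos s w.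
  move=> pv vw wn; apply: (@homo_interval (pos s) p n.-1) => //; last by lia.
  move=> u up; have u1 : u.+1 < n by lia. 
  have u0 := ltnW u1.
  have := H (Ordinal u0) (Ordinal u1) (erefl _); rewrite inE /=.
  have := posE s (Ordinal u0); have := posE s (Ordinal u1) => /= -> ->.
  have : (s^-1 (Ordinal u0))%g != (s^-1 (Ordinal u1))%g.
    by rewrite (inj_eq perm_inj) -val_eqE /=; lia.
  by rewrite -val_eqE /=; lia.
have posS (i : 'I_n) : pos s (s i) = i.+1 by rewrite posE permK.
split=> [i i0|i j ij].
  have := posE s (Ordinal pn); have := posS i; rewrite i0.
  case: (ltngtP (s i) p) => // lt.
    by have := desc _ _ lt (leqnn p) => /=; lia.
  by have := asc _ _ (leqnn p) lt (ltn_ord _) => /=; lia.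
rewrite /vrel; apply/andP; split; apply/implyP => lt.
  rewrite ltnNge; apply/negP => tp; have := desc _ _ lt tp; rewrite !posS; lia.
rewrite ltnNge; apply/negP => tp; have := asc _ _ tp lt (ltn_ord _).
by rewrite !posS; lia.
Qed.

(** This says that [s] is the standardization of [u]. *)
Definition order_iso n (u : seq nat) (s : 'S_n) : Prop :=
  forall i j : 'I_n, (nth 0 u i < nth 0 u j) = (s i < s j).

Lemma standardization n (u : seq nat) : uniq u -> size u = n ->
  exists s : 'S_n, order_iso u s.
Proof.
move=> Uu su; pose below (i : 'I_n) := [set k : 'I_n | nth 0 u k < nth 0 u i].
have mono (i j : 'I_n) : nth 0 u i < nth 0 u j -> #|below i| < #|below j|.
  move=> ij; apply/proper_card/properP; split.
    by apply/subsetP => k; rewrite !inE => /ltn_trans; apply.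
  by exists i; rewrite !inE ?ltnn.
have lt i : #|below i| < n.
  rewrite -[X in _ < X]card_ord -cardsT; apply/proper_card/properP.
  by split; [apply: subsetT | exists i; rewrite !inE ?ltnn].
pose f i := Ordinal (lt i).
have fE (i j : 'I_n) : (nth 0 u i < nth 0 u j) = (f i < f j).
  case: (ltngtP (nth 0 u i) (nth 0 u j)) => [/mono -> //|/mono/ltnW|e].
    by rewrite leqNgt => /negbTE.
  by rewrite /= /below e ltnn.
have finj : injective f.
  move=> i j e; apply/val_inj/eqP; rewrite -(nth_uniq 0 _ _ Uu) ?su ?ltn_ord //.
  by have := fE j i; have := fE i j; rewrite e ltnn; case: ltngtP.
by exists (perm finj) => i j; rewrite !permE fE.
Qed.

Lemma order_iso_uniq n (u : seq nat) (s : 'S_n) : size u = n -> order_iso u s -> uniq u.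
Proof.
move=> su H; apply/(uniqP 0) => i j; rewrite !inE su => il jl e.
have := H (Ordinal il) (Ordinal jl); have := H (Ordinal jl) (Ordinal il).
rewrite /= e ltnn; case: ltngtP => // /val_inj/perm_inj E _ _.
by have := congr1 val E.
Qed.

Lemma perm_rank n (s : 'S_n) (i : 'I_n) : #|[set j | s j < s i]| = s i.
Proof.
have -> : [set j | s j < s i] = s @^-1: [set v : 'I_n | v < s i].
  by apply/setP => j; rewrite !inE.
rewrite card_preimset; last exact: perm_inj.
have winj : injective (widen_ord (ltnW (ltn_ord (s i)))).
  by move=> v w /(congr1 val) /= e; apply: val_inj.
rewrite -[RHS]card_ord -(card_image winj).
apply: eq_card => v; rewrite inE; apply/idP/imageP => [lt|[w _ ->]].
  by exists (Ordinal lt) => //; apply: val_inj.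
by rewrite /= ltn_ord.
Qed.

Lemma count_lt_gt (u : seq nat) h : uniq u -> h \in u ->
  size u = (count (ltn^~ h) u + count (ltn h) u).+1.
Proof.
move=> Uu hu; rewrite -(count_predC (ltn^~ h)) -addnS; congr (_ + _).
have -> : count (predC (ltn^~ h)) u = count (predU (pred1 h) (ltn h)) u.
  by apply: eq_count => x /=; lia.
have := count_predUI (pred1 h) (ltn h) u.
rewrite (count_uniq_mem _ Uu) hu (@eq_count _ (predI _ _) pred0) ?count_pred0 => [|x /=].
  by rewrite addn0 add1n => ->.
by apply/negP => /andP[/eqP-> /=]; rewrite ltnn.
Qed.

Lemma seq_nth_ord n (u : seq nat) : size u = n ->
  u = [seq nth 0 u (i : 'I_n) | i <- enum 'I_n].
Proof.
move=> su; apply: (@eq_from_nth _ 0).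
  by rewrite su size_map size_enum_ord.
rewrite su => i il.
by rewrite (nth_map (Ordinal il)) ?size_enum_ord // nth_enum_ord.
Qed.

Lemma order_iso_vword n p q (u : seq nat) (s : 'S_n) :
  n = (p + q).+1 -> size u = n -> order_iso u s ->
  vperm p s <-> vword (head 0 u) p q u.
Proof.
move=> npq su iso; have n0 : 0 < n by rewrite npq.
pose o : 'I_n := Ordinal n0; have h0 : head 0 u = nth 0 u o by rewrite nth0.
have hu : head 0 u \in u by rewrite h0 mem_nth ?su.
have Uu := order_iso_uniq su iso.
have cp : count (ltn^~ (head 0 u)) u = s o.
  rewrite [X in count _ X](seq_nth_ord su) count_map -perm_rank.
  rewrite cardE enumT -size_filter; congr size; apply: eq_filter => k /=.
  by rewrite inE h0 iso.
have [cq sz] := (count_lt_gt Uu hu, su).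
have vE (i j : 'I_n) : vrel (nth 0 u o) (nth 0 u i) (nth 0 u j) = vrel (s o) (s i) (s j).
  by rewrite /vrel !iso.
split=> [[s0 sv]|[hd pw cp' cq']].
  have so := s0 o (erefl _); split.
  - by case: (u) hu.
  - apply/(pairwiseP 0) => i j; rewrite !inE su => il jl ij.
    by have := vE (Ordinal il) (Ordinal jl); rewrite -h0 /= => ->; rewrite so sv.
  - by rewrite cp.
  - by move: cq; rewrite cp so; lia.
have so : s o = p :> nat by rewrite -cp.
split=> [i i0|i j ij]; first by rewrite -so; congr (s _ : nat); apply: val_inj.
by rewrite -so -vE -h0; move/(pairwiseP 0): pw; apply; rewrite ?inE ?su.
Qed.

Lemma word_order_iso n (s : 'S_n) : order_iso (word s) s.
Proof. by move=> i j; rewrite !nth_word. Qed.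

Lemma containsP n k (s : 'S_k) (p : 'S_n) :
  reflect (exists f : 'I_n -> 'I_k, {homo f : i j / i < j} /\
             forall i j, (s (f i) < s (f j)) = (p i < p j))
          (contains s p).
Proof.
apply: (iffP existsP) => [[f /forallP H]|[f [mf sf]]].
  exists f; split=> [i j ij|i j]; have /forallP/(_ j)/andP[/implyP H1 /eqP H2] := H i.
    exact: H1.
  by [].
exists (finfun f); apply/forallP => i; apply/forallP => j; rewrite !ffunE sf eqxx andbT.
by apply/implyP => /mf.
Qed.

Lemma nth_seq_ord n (g : 'I_n -> nat) (i : 'I_n) : nth 0 [seq g i | i <- enum 'I_n] i = g i.
Proof. by rewrite (nth_map i) ?size_enum_ord // nth_ord_enum. Qed.

Lemma contains_subseq n k (s : 'S_k) (p : 'S_n) :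
  contains s p <-> exists u, [/\ subseq u (word s), size u = n & order_iso u p].
Proof.
split=> [/containsP[f [mf sf]]|[u [/subseq_wordP[v sv ->]]]].
  exists [seq (s (f i)).+1 | i <- enum 'I_n]; split.
  - apply/subseq_wordP; exists (map f (enum 'I_n)); last exact: (map_comp (fun j => (s j).+1) f).
    rewrite -map_comp; have : sorted ltn (map val (enum 'I_n)).
      by rewrite val_enum_ord iota_ltn_sorted.
    by rewrite !sorted_map; apply: sub_sorted => i j /= /mf.
  - by rewrite size_map size_enum_ord.
  - by move=> i j; rewrite !nth_seq_ord ltnS sf.
rewrite size_map => sz iso; apply/containsP.
case: n p sz iso => [|n] p sz iso.
  have f (i : 'I_0) : 'I_k by case: i.
  by exists f; split=> -[].
have k0 : 'I_k by case: v sz {sv iso} => [|i].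
exists (fun i => nth k0 v i); split=> [i j ij|i j].
  have := sorted_ltn_nth ltn_trans 0 sv i j; rewrite !inE size_map sz.
  by rewrite !(nth_map k0) ?sz //; apply.
by rewrite -iso !(nth_map k0) ?sz // ltnS.
Qed.

(** A pattern occurrence is a subword, and being a V-word depends only on the
    relative order of the letters. *)
Lemma contains_Dinv_initial n k p q (s : 'S_k) : n = (p + q).+1 ->
  (exists2 t : 'S_n, t \in Dinv (itv n 1 p) & contains s t) <->
  has_vword p q (word s).
Proof.
move=> npq; have pn : p < n by rewrite npq; lia.
split=> [[t /(vperm_Dinv _ pn) tv /contains_subseq[u [us su iso]]]|[m [u [us V]]]].
  by exists (head 0 u), u; split=> //; apply/(order_iso_vword npq su iso).
have Uu := subseq_uniq us (word_uniq s).
have mE : m = head 0 u by case: V; case: (u) => //= ? ? [].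
have su : size u = n.
  rewrite (@count_lt_gt _ m) //; first by case: V => _ _ -> ->.
  by case: V; rewrite mE; case: (u) => //= a l _ _ _ _; rewrite mem_head.
have [t iso] := standardization Uu su.
exists t; last by apply/contains_subseq; exists u.
by apply/(vperm_Dinv _ pn)/(order_iso_vword npq su iso); rewrite -mE.
Qed.

(** * Superstandard hooks *)

Lemma inv_lt_neg n (s : 'S_n) (i j : 'I_n) : i != j ->
  (s^-1 i < s^-1 j)%g = ~~ (s^-1 j < s^-1 i)%g.
Proof.
by move=> ij; rewrite ltn_neqAle -leqNgt val_eqE (inj_eq perm_inj) ij.
Qed.

Lemma Des_P n (s s' : 'S_n) : P s = P s' -> Des s^-1%g = Des s'^-1%g.
Proof.
move=> ss'; apply/(DesP _ (@Des_gt0 _ _)) => i j ji.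
have ij : j != i by rewrite -val_eqE /= ji; lia.
by rewrite (mem_Des _ ji) !(inv_lt_neg _ ij) (inv_descents_P ji ss').
Qed.

(** Reversal complements the inverse descent set. *)
Lemma Dinv_reverse n p (s : 'S_n) : p < n ->
  (reverse s \in Dinv (itv n 1 p)) = (s \in Dinv (itv n p.+1 (n - 1))).
Proof.
move=> pn; rewrite !DinvE.
have J0 (i : 'I_n) : i \in itv n p.+1 (n - 1) -> 0 < i by rewrite inE; lia.
suff H : Des (reverse s)^-1%g = itv n 1 p <-> Des s^-1%g = itv n p.+1 (n - 1).
  by apply/eqP/eqP => /H.
rewrite (DesP _ (@itv1_gt0 n p)) (DesP _ J0).
have key (i j : 'I_n) : j = i.+1 :> nat ->
    ((reverse s)^-1%g j < (reverse s)^-1%g i) = ~~ (s^-1%g j < s^-1%g i) /\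
    (j \in itv n 1 p) = ~~ (j \in itv n p.+1 (n - 1)).
  move=> ji; have ij : i != j by rewrite -val_eqE /= ji; lia.
  rewrite -(inv_lt_neg _ ij) !reverse_inv /= !inE.
  have := ltn_ord (s^-1%g j); have := ltn_ord (s^-1%g i); have := ltn_ord j.
  by split; lia.
by split=> H i j ji; have [e1 e2] := key i j ji; have := H i j ji; rewrite e1 e2; 
  [move/negb_inj | move=> ->].
Qed.

(** The hook with first column [C] and arm [R]; the corner is the head of [C]. *)
Definition hook (C R : seq nat) : tableau :=
  (head 0 C :: R) :: [seq [:: y] | y <- behead C].

Lemma tab_insert_column h C : sorted ltn (h :: C) ->
  tab_insert h [seq [:: y] | y <- C] = [seq [:: y] | y <- h :: C].
Proof. by elim: C h => //= y C IH h /andP[-> /IH ->]. Qed.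

Lemma tab_insert_hook_min w C R : sorted ltn (w :: C) -> C != [::] ->
  tab_insert w (hook C R) = hook (w :: C) R.
Proof.
case: C => //= h C /andP[wh sC] _; rewrite /hook /= wh.
by rewrite tab_insert_column.
Qed.

Lemma row_insert_max x r : all (leq^~ x) r -> row_insert x r = (None, rcons r x).
Proof. by elim: r => //= h r IH /andP[hx /IH ->]; rewrite ltnNge hx. Qed.

Lemma tab_insert_hook_max z C R : all (leq^~ z) (head 0 C :: R) ->
  tab_insert z (hook C R) = hook C (rcons R z).
Proof. by move=> H; rewrite /hook; cbn [tab_insert]; rewrite row_insert_max. Qed.

Lemma vword_column_sorted m u : uniq (m :: u) -> pairwise (vrel m) (m :: u) ->
  sorted ltn (rev (m :: filter (ltn^~ m) u)).
Proof.
move=> Uu pu; rewrite rev_sorted; apply: pairwise_sorted.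
have sub : subseq (m :: filter (ltn^~ m) u) (m :: u).
  by rewrite -cat1s -[m :: u]cat1s cat_subseq ?filter_subseq.
have := subseq_pairwise sub pu; have := subseq_uniq sub Uu; rewrite uniq_pairwise.
move=> U V; have : pairwise [rel a b | (a != b) && vrel m a b] (m :: filter (ltn^~ m) u).
  by rewrite pairwise_relI U.
apply: (@sub_in_pairwise _ (leq^~ m)) => [a b am bm /=|].
  by move: am bm; rewrite !unfold_in /vrel; lia.
by rewrite /= leqnn; apply/allP => a; rewrite mem_filter => /andP[/ltnW].
Qed.

Lemma vword_row_sorted m u : uniq (m :: u) -> pairwise (vrel m) (m :: u) ->
  sorted ltn (m :: filter (ltn m) u).
Proof.
move=> Uu pu; apply: pairwise_sorted.
have sub : subseq (m :: filter (ltn m) u) (m :: u).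
  by rewrite -cat1s -[m :: u]cat1s cat_subseq ?filter_subseq.
have := subseq_pairwise sub pu; have := subseq_uniq sub Uu; rewrite uniq_pairwise.
move=> U V; have : pairwise [rel a b | (a != b) && vrel m a b] (m :: filter (ltn m) u).
  by rewrite pairwise_relI U.
apply: (@sub_in_pairwise _ (leq m)) => [a b am bm /=|].
  by move: am bm; rewrite !unfold_in /vrel; lia.
by rewrite /= leqnn; apply/allP => a; rewrite mem_filter => /andP[/ltnW].
Qed.

(** A new maximum is appended to the first row; a new minimum bumps the corner
    and thereby pushes the whole first column down. *)
Lemma insertion_vword m u : uniq (m :: u) -> pairwise (vrel m) (m :: u) ->
  insertion_tableau (m :: u) =
    hook (rev (m :: filter (ltn^~ m) u)) (filter (ltn m) u).
Proof.
elim/last_ind: u => [|u x IH] // Ux px.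
have sub : subseq (m :: u) (m :: rcons u x) by rewrite -rcons_cons subseq_rcons.
have {}IH := IH (subseq_uniq sub Ux) (subseq_pairwise sub px).
rewrite /insertion_tableau -rcons_cons foldl_rcons -/(insertion_tableau _) IH.
have cs := vword_column_sorted Ux px; have rs := vword_row_sorted Ux px.
have e : (ltn x m = (x < m)) * (ltn m x = (m < x)) by [].
move: cs rs; rewrite !filter_rcons !e; case: (ltngtP x m) => [xm|mx|xm] cs rs.
- rewrite -rcons_cons rev_rcons in cs *.
  by rewrite tab_insert_hook_min // -size_eq0 size_rev.
- rewrite tab_insert_hook_max //=; apply/andP; split.
    set c := head 0 _; have : c \in m :: [seq y <- u | y < m].
      by rewrite -mem_rev /c; case: rev (size_rev (m :: [seq y <- u | y < m])) => //= *;
         rewrite mem_head.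
    by rewrite inE mem_filter => /orP[/eqP->|/andP[/= cm _]]; lia.
  have := rs; rewrite -rcons_cons -cats1 (sorted_pairwise ltn_trans).
  rewrite pairwise_cat => /andP[/allrelP H _]; apply/allP => y yR /=.
  by apply/ltnW/H; rewrite inE ?yR ?orbT.
- by move: Ux; rewrite xm /= mem_rcons mem_head.
Qed.

(** The superstandard hooks with [p + q + 1] boxes; [p] counts the boxes next to
    the corner in the first column, respectively in the first row. *)
Definition column_hook p q := hook (iota 1 p.+1) (iota p.+2 q).
Definition row_hook p q := hook (1 :: iota p.+2 q) (iota 2 p).

(** The first column, read downwards and followed by the arm, is a sorted
    rearrangement of [1, ..., n]. *)
Lemma P_vperm n p q (s : 'S_n) : n = (p + q).+1 -> vperm p s -> P s = column_hook p q.
Proof.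
move=> npq /(order_iso_vword npq (size_word s) (@word_order_iso _ s)).
rewrite /P; have := word_uniq s; have := perm_word s; have := size_word s.
case: (word s) => [|m u]; first by rewrite npq.
move=> sz pw Uw [_ pr cp _].
rewrite insertion_vword //=; set C := rev _; set R := filter _ _.
have sC : size C = p.+1 by rewrite size_rev /= size_filter -cp /= ltnn.
suff : C ++ R = iota 1 n.
  rewrite npq -addSn iotaD add1n => /eqP.
  by rewrite eqseq_cat ?sC ?size_iota // => /andP[/eqP-> /eqP->].
have Cm c : c \in C -> c <= m.
  by rewrite mem_rev inE mem_filter => /orP[/eqP->|/andP[/= /ltnW]].
apply: (irr_sorted_eq ltn_trans ltnn).
- apply: pairwise_sorted; rewrite pairwise_cat.
  have := vword_column_sorted Uw pr; have /= := vword_row_sorted Uw pr.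
  rewrite -/R -/C => /path_sorted; rewrite !(sorted_pairwise ltn_trans).
  move=> -> ->; rewrite !andbT; apply/allrelP => a b /Cm am.
  by rewrite mem_filter => /andP[/=]; lia.
- exact: iota_ltn_sorted.
move=> x; rewrite -(perm_mem pw) mem_cat mem_rev !inE !mem_filter /=.
by case: (x \in u) => /=; rewrite ?andbT ?andbF ?orbF ?orbT; lia.
Qed.

(** One explicit V-word in each inverse descent class. Its reversal is the
    reading word of the row superstandard hook ([reading_row_hook]). *)
Lemma canonical_vperm n p q : n = (p + q).+1 ->
  exists2 s : 'S_n, vperm p s & word s = rev (iota 1 p.+1) ++ iota p.+2 q.
Proof.
move=> npq; have lt (i : 'I_n) : (if i <= p then p - i else i) < n.
  by have := ltn_ord i; case: ifP; lia.
have finj : injective (fun i => Ordinal (lt i)).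
  move=> i j /(congr1 val) /= e; apply: val_inj => /=; move: e.
  by case: ifP; case: ifP; lia.
exists (perm finj).
  split=> [i i0|i j ij]; rewrite !permE /= ?i0 //=; first by lia.
  by rewrite /vrel; case: ifP; case: ifP; lia.
apply: (@eq_from_nth _ 0) => [|i].
  by rewrite size_word size_cat size_rev !size_iota; lia.
rewrite size_word => il; rewrite (nth_word _ (Ordinal il)) permE.
rewrite nth_cat size_rev size_iota ltnS [val _]/=; case: ifP => ip.
  by rewrite nth_rev size_iota ?ltnS // nth_iota; lia.
by rewrite nth_iota; lia.
Qed.

Lemma young_row_hook p q : young (row_hook p q).
Proof.
rewrite /row_hook /hook /=; apply/and3P; split.
- by rewrite inE /=; apply/mapP => -[].
- rewrite -[1 :: iota 2 p]/(iota 1 p.+1) /= all_map.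
  rewrite -[path leq 1 _]/(sorted leq (iota 1 p.+1)) iota_sorted.
  by apply/allP.
have : forall x, x < p.+2 -> sorted above ((x :: iota 2 p) :: [seq [:: y] | y <- iota p.+2 q]).
  case: q => // q x xp /=; rewrite xp above_nil /=.
  by elim: q (p.+2) => //= q IH k; rewrite ltnS leqnn /= IH.
by apply.
Qed.

Lemma reading_row_hook p q :
  reading_word (row_hook p q) = rev (rev (iota 1 p.+1) ++ iota p.+2 q).
Proof.
rewrite rev_cat revK reading_word_cons; congr (_ ++ _).
rewrite /reading_word -map_rev /=; elim: (rev _) => //= a l IH.
by rewrite IH.
Qed.

(** All V-words of the same type are Knuth equivalent, hence so are their
    reversals, and one of these is the reading word of the row hook. *)
Lemma P_reverse_vperm n p q (s : 'S_n) : n = (p + q).+1 ->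
  vperm p s -> P (reverse s) = row_hook p q.
Proof.
move=> npq sv; have [t tv wt] := canonical_vperm npq.
have /P_reverse -> : P s = P t by rewrite !(P_vperm npq).
by rewrite /P word_reverse wt -reading_row_hook insert_reading_word ?young_row_hook.
Qed.

(** The class is contained in an inverse descent class because the inverse
    descent set is a Knuth invariant; the other inclusion is [P_vperm]. *)
Lemma P_column_hook n p q (s : 'S_n) : n = (p + q).+1 ->
  P s = column_hook p q <-> s \in Dinv (itv n 1 p).
Proof.
move=> npq; have pn : p < n by rewrite npq; lia.
split=> [Ps|/(vperm_Dinv _ pn)]; last exact: P_vperm.
have [t tv _] := canonical_vperm npq.
have := tv => /(vperm_Dinv _ pn); rewrite !DinvE -(@Des_P _ s t) //.
by rewrite Ps (P_vperm npq).
Qed.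

Lemma P_row_hook n p q (s : 'S_n) : n = (p + q).+1 ->
  P s = row_hook p q <-> s \in Dinv (itv n p.+1 (n - 1)).
Proof.
move=> npq; have pn : p < n by rewrite npq; lia.
rewrite -Dinv_reverse // -(P_column_hook _ npq).
have [t tv _] := canonical_vperm npq.
rewrite -(P_vperm npq tv) -(P_reverse_vperm npq tv).
by split=> [/P_reverse|/P_reverse]; rewrite reverseK.
Qed.

Lemma transpose_hook x C R :
  transpose (hook (x :: C) R) = hook (x :: R) C.
Proof.
rewrite /transpose /hook /=; congr (_ :: _).
  by congr (_ :: _); elim: C => //= y C IH; rewrite IH.
rewrite -[1]/(1 + 0) iotaDl -map_comp -[in RHS](mkseq_nth 0 R) /mkseq -map_comp.
apply/eq_in_map => j; rewrite mem_iota add0n => /andP[_ jR] /=.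
rewrite ltnS jR /= (@eq_in_filter _ _ pred0) ?filter_pred0 // => r /mapP[y _ ->].
by [].
Qed.

Lemma shape_hook C R : shape (hook C R) = (size R).+1 :: nseq (size (behead C)) 1.
Proof. by rewrite /hook /=; congr (_ :: _); elim: (behead C) => //= a l ->. Qed.

Lemma hook_of_shape (T : tableau) : hook_shaped T ->
  exists x C R, T = hook (x :: C) R.
Proof.
case=> a [b [a0]]; case: T => [|[|x R] T] //= [e sT]; first by rewrite -e in a0.
exists x, (flatten T), R; rewrite /hook /=; congr (_ :: _).
elim: T b sT {e} => //= -[|y [|z r]] T IH [|b] //= [] sT.
by rewrite -(IH _ sT).
Qed.

Lemma flatten_hook x C R : flatten (hook (x :: C) R) = x :: R ++ C.
Proof. by rewrite /hook /=; congr (_ :: _ ++ _); elim: C => //= y C ->. Qed.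

Lemma row_superstandardE T :
  row_superstandard T <-> flatten T = iota 1 (size (flatten T)).
Proof.
rewrite /row_superstandard size_flatten; split=> [{1}->|E].
  by rewrite reshapeKr // size_iota.
by rewrite -E flattenK.
Qed.

Lemma row_superstandard_row_hook p q : row_superstandard (row_hook p q).
Proof.
apply/row_superstandardE; rewrite flatten_hook.
by rewrite /= size_cat !size_iota iotaD.
Qed.

Lemma superstandard_hookP n S : is_SYT n S ->
  superstandard_hook S <->
  exists p q, n = (p + q).+1 /\ (S = column_hook p q \/ S = row_hook p q).
Proof.
rewrite is_SYT_young => /andP[_ /perm_size]; rewrite size_iota => sS.
split=> [[ss /hook_of_shape[x [C [R eS]]]]|[p [q [_ [->|->]]]]]; last 2 first.
- split; last by exists q.+1, p; rewrite shape_hook !size_iota.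
  by right; rewrite /column_superstandard transpose_hook; apply: row_superstandard_row_hook.
- split; last by exists p.+1, q; rewrite shape_hook /= !size_iota.
  by left; apply: row_superstandard_row_hook.
have split_iota (A B : seq nat) : x :: A ++ B = iota 1 (size (x :: A ++ B)) ->
    [/\ x = 1, A = iota 2 (size A) & B = iota (size A).+2 (size B)].
  rewrite /= size_cat iotaD => -[-> /eqP].
  by rewrite eqseq_cat ?size_iota // => /andP[/eqP eA /eqP eB].
case: ss; rewrite /column_superstandard eS ?transpose_hook.
  move/row_superstandardE; rewrite flatten_hook => /split_iota[x1 eR eC].
  exists (size R), (size C); split; first by rewrite -sS eS flatten_hook /= size_cat.
  by right; rewrite x1 /row_hook -eR -eC.
move/row_superstandardE; rewrite flatten_hook => /split_iota[x1 eC eR].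
exists (size C), (size R); split.
  by rewrite -sS eS flatten_hook /= size_cat addnC.
by left; rewrite x1 /column_hook /= -eR -eC.
Qed.

Lemma Dinv_itv_nonempty n p q : n = (p + q).+1 ->
  (exists s : 'S_n, P s = column_hook p q) /\ (exists s : 'S_n, P s = row_hook p q).
Proof.
move=> npq; have [t tv _] := canonical_vperm npq.
split; [by exists t; apply: P_vperm | by exists (reverse t); apply: P_reverse_vperm].
Qed.

Definition initial_or_final_Dinv n (Pi : {set 'S_n}) : Prop :=
  exists J : {set 'I_n}, Pi = Dinv J /\
    exists k : nat, (k <= n - 1 /\ J = itv n 1 k) \/
                    (1 <= k <= n /\ J = itv n k (n - 1)).

Lemma initial_or_final_DinvP n (Pi : {set 'S_n}) : 0 < n ->
  initial_or_final_Dinv Pi <->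
  exists p q, n = (p + q).+1 /\
    (Pi = knuth_class n (column_hook p q) \/ Pi = knuth_class n (row_hook p q)).
Proof.
move=> n0; have colE p q : n = (p + q).+1 ->
    knuth_class n (column_hook p q) = Dinv (itv n 1 p).
  move=> npq; apply/setP => s; rewrite inE.
  by apply/eqP/idP => /(P_column_hook s npq).
have rowE p q : n = (p + q).+1 ->
    knuth_class n (row_hook p q) = Dinv (itv n p.+1 (n - 1)).
  move=> npq; apply/setP => s; rewrite inE.
  by apply/eqP/idP => /(P_row_hook s npq).
split=> [[J [-> [k [[kn ->]|[kn ->]]]]]|[p [q [npq [->|->]]]]].
- have npq : n = (k + (n - 1 - k)).+1 by lia.
  by exists k, (n - 1 - k); split=> //; left; rewrite colE.
- have npq : n = (k.-1 + (n - k)).+1 by lia.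
  exists k.-1, (n - k); split=> //; right; rewrite rowE // prednK //.
  by case/andP: kn.
- by exists (itv n 1 p); split; [apply: colE | exists p; left; split=> //; lia].
- exists (itv n p.+1 (n - 1)); split; first exact: rowE.
  by exists p.+1; right; split=> //; lia.
Qed.

Lemma initial_or_final_superstandard n S (Pi : {set 'S_n}) : 0 < n -> is_SYT n S ->
  Pi = knuth_class n S -> initial_or_final_Dinv Pi <-> superstandard_hook S.
Proof.
move=> n0 hS hPi; rewrite initial_or_final_DinvP // (superstandard_hookP hS).
split=> -[p [q [npq e]]]; exists p, q; split=> //; last first.
  by case: e => e; rewrite hPi e; [left|right].
have [[s Ps] [t Pt]] := Dinv_itv_nonempty npq.
case: e; rewrite hPi => /setP E; [left|right].
  by have := E s; rewrite !inE Ps eqxx => /eqP.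
by have := E t; rewrite !inE Pt eqxx => /eqP.
Qed.

Lemma mem_knuth_classes n (s : 'S_n) Ts :
  (s \in \bigcup_(T <- Ts) knuth_class n T) = (P s \in Ts).
Proof.
elim: Ts => [|T Ts IH]; first by rewrite big_nil inE.
by rewrite big_cons in_setU IH !inE.
Qed.

(** The avoiders form a union of Knuth classes exactly when containment of some
    element of [Pi] depends on the insertion tableau only. *)
Lemma pattern_knuth_closedP n (Pi : {set 'S_n}) :
  pattern_knuth_closed Pi <->
  forall k (s s' : 'S_k) (t : 'S_n), P s = P s' -> t \in Pi -> contains s t ->
    exists2 t' : 'S_n, t' \in Pi & contains s' t'.
Proof.
split=> [H k s s' t ss' tPi st|H k].
  apply/exists_inP; apply: contraTT st; rewrite negb_exists_in => /forall_inP av'.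
  have [Ts _ /setP E] := H k; have : s' \in avoiders Pi k.
    by rewrite inE; apply/forall_inP.
  have <- : (s \in avoiders Pi k) = (s' \in avoiders Pi k).
    by rewrite !E !mem_knuth_classes ss'.
  by rewrite inE => /forall_inP; apply.
exists [seq P s | s <- enum (avoiders Pi k)].
  by apply/allP => T /mapP[s _ ->]; apply: P_SYT.
apply/setP => s; rewrite mem_knuth_classes; apply/idP/mapP => [sA|[s']].
  by exists s; rewrite ?mem_enum.
rewrite mem_enum => s'A ss'.
rewrite inE; apply/forall_inP => t tPi; apply/negP => st.
have [t' t'Pi s't'] := H _ _ _ _ ss' tPi st.
by move: s'A; rewrite inE => /forall_inP/(_ _ t'Pi); rewrite s't'.
Qed.

Lemma contains_reverse n k (s : 'S_k) (t : 'S_n) :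
  contains s t -> contains (reverse s) (reverse t).
Proof.
case/containsP => f [mf sf]; apply/containsP.
exists (fun i => rev_ord (f (rev_ord i))); split=> [i j ij|i j].
  rewrite /=; have := mf (rev_ord j) (rev_ord i); rewrite /=.
  have := ltn_ord (f (rev_ord i)); have := ltn_ord (f (rev_ord j)).
  have := ltn_ord i; have := ltn_ord j; lia.
by rewrite !reverseE !rev_ordK sf.
Qed.

(** For an initial interval, containing an element of [Pi] means containing a
    V-word of a given type, which is a Knuth invariant; a final interval is
    reduced to this case by reversal. *)
Lemma initial_or_final_closed n (Pi : {set 'S_n}) : 0 < n ->
  initial_or_final_Dinv Pi -> pattern_knuth_closed Pi.
Proof.
move=> n0 [J [-> H]]; apply/pattern_knuth_closedP => k s s' t ss' tJ st.
case: H tJ => a [[an ->]|[an ->]] tJ.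
  have npq : n = (a + (n - 1 - a)).+1 by lia.
  apply/(contains_Dinv_initial _ npq)/(P_has_vword ss')/(contains_Dinv_initial _ npq).
  by exists t.
have npq : n = (a.-1 + (n - a)).+1 by lia.
have an1 : a.-1 < n by lia.
have ea : a.-1.+1 = a by lia.
have [t' t'J s't'] : exists2 t', t' \in Dinv (itv n 1 a.-1) & contains (reverse s') t'.
  apply/(contains_Dinv_initial _ npq)/(P_has_vword (P_reverse ss')).
  apply/(contains_Dinv_initial _ npq).
  exists (reverse t); last exact: contains_reverse.
  by rewrite Dinv_reverse // ea.
exists (reverse t'); last by rewrite -[s']reverseK; apply: contains_reverse.
by rewrite -ea -Dinv_reverse // reverseK.
Qed.

(** A swap preserves the relative order of any two values other than the two
    exchanged ones, and these are not consecutive. *)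
Lemma Dinv_swap_closed n (J : {set 'I_n}) : swap_closed (Dinv J).
Proof.
move=> s i j; rewrite !DinvE => /eqP <- ji sij; apply/eqP.
apply/(DesP _ (@Des_gt0 _ _)) => a b ba; rewrite (mem_Des _ ba) invMg tpermV !permM.
set u := (s^-1 a)%g; set v := (s^-1 b)%g.
have uv : u != v by rewrite (inj_eq perm_inj) -val_eqE /= ba; lia.
have nuv : ~~ ((u == i) && (v == j) || (u == j) && (v == i)).
  apply/negP => /orP[]/andP[/eqP e /eqP e']; move: sij;
    rewrite -e -e' /u /v !permKV ba; lia.
have tE (x : 'I_n) : (tperm i j x : nat) =
    if x == i :> nat then j : nat else if x == j :> nat then i : nat else x.
  by rewrite !val_eqE; case: tpermP => [->|->|/eqP/negbTE-> /eqP/negbTE->];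
     rewrite ?eqxx //; case: eqP => // ->.
rewrite !tE; move: uv nuv; rewrite -!val_eqE /=.
by case: ifP => /eqP; [|case: ifP => /eqP]; (case: ifP => /eqP; [|case: ifP => /eqP]); lia.
Qed.

(** * Earliest permutations and deletion of a letter *)

(** These are the layered permutations, the direct sums of decreasing ones. *)
Definition unit_descents n (s : 'S_n) : Prop :=
  forall i j : 'I_n, j = i.+1 :> nat -> s j < s i -> s i = (s j).+1 :> nat.

(** This implies that the inverse of [s'] is lexicographically smaller than the
    inverse of [s]. *)
Definition earlier n (s' s : 'S_n) : Prop :=
  exists a : 'I_n, (forall v : 'I_n, v <= a -> s'^-1 v <= s^-1 v)%g /\
                   (s'^-1 a < s^-1 a)%g.

Lemma lexi_earlier (u v : seq nat) a : a < size u -> a < size v ->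
  (forall i, i <= a -> nth 0 u i <= nth 0 v i) -> nth 0 u a < nth 0 v a ->
  ~~ ((v : seqlexi nat) <= u)%O.
Proof.
elim: a u v => [|a IH] [|x u] [|y v] //= su sv H lt; rewrite Order.SeqLexiOrder.lexi_cons.
  by rewrite Order.NatOrder.leEnat leqNgt lt.
have := H 0 isT; rewrite /= => xy.
rewrite negb_and negb_imply !Order.NatOrder.leEnat xy /=.
apply/orP; right; apply: IH => // i ia; exact: (H i.+1).
Qed.

Lemma exists_earliest n (A : {set 'S_n}) s0 : s0 \in A ->
  exists2 s, s \in A & forall s', s' \in A -> ~ earlier s' s.
Proof.
move=> s0A; pose F (s : 'S_n) : seqlexi nat := word s^-1%g.
case: (@Order.TotalTheory.arg_minP _ _ _ s0 (mem A) F s0A) => s sA H.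
exists s => // s' /H le [a [av aa]]; move: le; apply/negP.
apply: (@lexi_earlier _ _ a); rewrite ?size_word ?ltn_ord //.
  move=> i ia; have il := leq_ltn_trans ia (ltn_ord a).
  by rewrite !(nth_word _ (Ordinal il)) ltnS av.
by rewrite !nth_word ltnS.
Qed.

Lemma bump_lt E x y : (bump E x < bump E y) = (x < y).
Proof. by rewrite !ltnNge leq_bump2. Qed.

(** The situation of [closed_unit_descents] in terms of positions as functions
    of values. In [t] the values [c] and [a], with [c > a + 1], occupy the
    positions [p] and [p + 1]. A new value is inserted directly above [a], and
    [h] gives the positions in the resulting word where the new value, [a] and
    [c] stand in this order at [p], [p + 1] and [p + 2]. Deleting the value [D]
    from this word, at position [E], leaves [t2]. If [t2] has the same descents
    as [t], it has moved [a] and all smaller values to the left. *)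
Section LetterDeletion.

Variables (m a c p D E : nat) (t t2 h : nat -> nat).
Hypotheses (ac : a.+1 < c) (cm : c <= m) (ta : t a = p.+1) (tc : t c = p).
Hypothesis t_inj : forall v w, v <= m -> w <= m -> t v = t w -> v = w.
Hypothesis h_new : h a.+1 = p.
Hypothesis h_a : h a = p.+1.
Hypothesis h_old : forall v, v <= m -> v <> a -> v <> c ->
  h (bump a.+1 v) = t v + (p < t v).
Hypothesis hD : h D = E.
Hypothesis Dm : D <= m.+1.
Hypothesis h_t2 : forall v, v <= m -> h (bump D v) = bump E (t2 v).
Hypothesis same_descents : forall v, v < m -> (t2 v.+1 < t2 v) = (t v.+1 < t v).
Hypothesis no_crossing : forall d u, u < d -> d < a -> t a < t u -> t u < t d -> False.

Let h_lt v : v < a -> [/\ h v = t v + (p < t v), t v <> p & t v <> p.+1].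
Proof.
move=> va; have -> : h v = h (bump a.+1 v).
  by rewrite /bump leqNgt ltnS (ltnW va).
rewrite h_old; [|lia..]; split=> // e.
  by have := @t_inj v c; rewrite e tc; lia.
by have := @t_inj v a; rewrite e ta; lia.
Qed.

Let h_gt v : a < v -> v <= m -> v <> c -> h v.+1 = t v + (p < t v).
Proof. by move=> av vm vc; rewrite -h_old ?/bump ?av //; lia. Qed.

Let t2_lt v : v < D -> v <= m -> h v = bump E (t2 v).
Proof. by move=> vD vm; rewrite -h_t2 // /bump leqNgt vD. Qed.

Let t2_ge v : D <= v -> v <= m -> h v.+1 = bump E (t2 v).
Proof. by move=> vD vm; rewrite -h_t2 // /bump vD. Qed.

Let desc_lt v : v.+1 < D -> (t v.+1 < t v) = (h v.+1 < h v).
Proof.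
by move=> vD; rewrite -same_descents; [rewrite !t2_lt ?bump_lt //; lia|lia].
Qed.

Let desc_ge v : D <= v -> v < m -> (t v.+1 < t v) = (h v.+2 < h v.+1).
Proof.
by move=> vD vm; rewrite -same_descents // !t2_ge ?bump_lt //; lia.
Qed.

(** The new value creates a descent between the values [a] and [a + 1] in [h].
    If a value above it is deleted, that descent survives, so [t] has a descent
    there as well, and the argument propagates upwards: all values up to the
    deleted one form a chain of descents, and lie to the left of [p]. *)
Let chain_above j : a < j -> j < D -> [/\ t j < p, h j.+1 = t j & t j < h j].
Proof.
elim: j => // j IH aj jD.
have [tp tj] : t j.+1 < p /\ t j.+1 < h j.+1.
  have := desc_lt jD; move: aj; rewrite ltnS leq_eqVlt => /orP[/eqP <-|aj].
    rewrite h_new h_a ltnSn ta.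
    by have := @t_inj a.+1 c; rewrite tc; lia.
  by have [tp -> ->] := IH aj (ltnW jD); lia.
split=> //; rewrite h_gt ?(leq_gtF (ltnW tp)) ?addn0 //; first by lia.
by move=> e; move: tp; rewrite e tc ltnn.
Qed.

(** The same propagation downwards: all values from the deleted one to [a] form
    a chain of descents, and lie to the right of [p + 1]. *)
Let chain_below j : D <= j -> j < a -> p.+1 < t j /\ h j.+1 <= t j.
Proof.
move=> Dj ja; have [k] : exists k, j + k.+1 = a by exists (a - j.+1); lia.
elim: k j Dj ja => [|k IH] j Dj ja jk; have jm : j < m by lia.
  have ja1 : j.+1 = a by lia.
  by have := desc_ge Dj jm; rewrite ja1 h_new h_a ltnSn ta; lia.
have [tp hj] := IH j.+1 (leqW Dj) (ltac:(lia)) (ltac:(lia)).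
have [hj1 _ _] := @h_lt j.+1 (ltac:(lia)).
by have := desc_ge Dj jm; rewrite hj1; lia.
Qed.

(** Deleting [a] or the new value amounts to exchanging [c] and [a] in [t].
    If the deleted value lies above [a + 1], it is removed on the left of [p],
    which compensates the insertion for every letter on its right. If it lies
    below [a], each value of the chain takes over the place of its
    successor, and no smaller value lies in between. *)
Lemma letters_move_left : (forall v, v <= a -> t2 v <= t v) /\ t2 a < t a.
Proof.
have am : a <= m by lia.
have le0 x y z : y = bump x z -> z <= y by rewrite /bump; lia.
have [aD|Da|Da] := ltngtP a D.
- have [tE hE] : t2 a = p /\ (forall v, v < a -> t2 v <= t v).
    (* The new value has index [a + 1] in [h]. *)
    have [D1|D1] : D = a.+1 \/ a.+1 < D by lia.
      have Ep : E = p by rewrite -hD D1 h_new.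
      split=> [|v va].
        by have := t2_lt aD am; rewrite h_a Ep /bump; lia.
      have := t2_lt (ltn_trans va aD) (ltac:(lia)).
      by have [-> ? ?] := h_lt va; rewrite Ep /bump; lia.
    have [||tD hD1 _] := @chain_above D.-1; [lia|lia|].
    have ED : E = t D.-1 by rewrite -hD -hD1 prednK //; lia.
    have Ep : E < p by rewrite ED.
    split=> [|v va].
      by have := t2_lt aD am; rewrite h_a /bump; lia.
    have := t2_lt (ltn_trans va aD) (ltac:(lia)).
    by have [-> ? ?] := h_lt va; rewrite /bump; lia.
  split=> [v|]; last by rewrite tE ta.
  by rewrite leq_eqVlt => /orP[/eqP->|/hE//]; rewrite tE ta leqnSn.
- have [tD _] := chain_below (leqnn D) Da.
  have ED : E = (t D).+1.
    by rewrite -hD; have [-> _ _] := h_lt Da; lia.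
  have t2a : t2 a = p by have := t2_ge (ltnW Da) am; rewrite h_new /bump; lia.
  split=> [v|]; last by rewrite t2a ta.
  rewrite leq_eqVlt => /orP[/eqP->|va]; first by rewrite t2a ta leqnSn.
  have vm : v <= m by lia.
  have [vD|Dv] := ltnP v D.
    have := t2_lt vD vm; have [-> v0 v1] := h_lt va.
    have := @no_crossing D v vD Da; rewrite ta ED /bump.
    by have := @t_inj v D vm; lia.
  have [_ hv] := chain_below Dv va.
  by apply: leq_trans hv; apply: le0 (t2_ge Dv vm).
- have Ep : E = p.+1 by rewrite -hD -Da.
  have t2a : t2 a = p by have := @t2_ge a; rewrite Da leqnn -Da h_new Ep /bump; lia.
  split=> [v|]; last by rewrite t2a ta.
  rewrite leq_eqVlt => /orP[/eqP->|va]; first by rewrite t2a ta leqnSn.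
  have := @t2_lt v; rewrite -Da Ep => /(_ va (ltac:(lia))).
  by have [-> v0 v1] := h_lt va; rewrite /bump; lia.
Qed.

End LetterDeletion.

(** A value is determined by the number of smaller values. *)
Lemma perm_order_inj n (s t : 'S_n) :
  (forall i j, (s i < s j) = (t i < t j)) -> s = t.
Proof.
move=> H; apply/permP => i; apply: val_inj; rewrite -[LHS]perm_rank -[RHS]perm_rank.
by apply: eq_card => j; rewrite !inE H.
Qed.

Lemma order_iso_lift n (f : 'I_n -> 'I_n.+1) (D : 'I_n.+1) (t : 'S_n) :
  (forall i, f i != D) -> (forall i j, (f i < f j) = (t i < t j)) ->
  forall i, f i = lift D (t i).
Proof.
move=> fD H; pose g i := odflt i (unlift D (f i)).
have fE i : f i = lift D (g i).
  by rewrite /g; have := fD i; case: unliftP => [j ->//|->]; rewrite eqxx.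
have gE i j : (g i < g j) = (t i < t j) by rewrite -H !fE /= bump_lt.
have ginj : injective g.
  move=> i j e; have := gE i j; have := gE j i; rewrite e ltnn.
  by case: ltngtP => // /val_inj/perm_inj.
have e : perm ginj = t by apply: perm_order_inj => i j; rewrite !permE gE.
by move=> i; rewrite fE -e permE.
Qed.

(** An increasing map into one more point misses exactly one point, so patterns
    with one letter fewer are obtained by deleting a letter. *)
Lemma contains_lift_perm n (s : 'S_n.+1) (t : 'S_n) :
  contains s t <-> exists E D, s = lift_perm E D t.
Proof.
split=> [/containsP[f [mf sf]]|[E [D ->]]]; last first.
  apply/containsP; exists (lift E).
  by split=> [i j ij|i j]; rewrite ?lift_perm_lift /= bump_lt.
have fE i j : (f i < f j) = (i < j).
  case: (ltngtP i j) => [/mf->//|/mf ji|/val_inj->]; last by rewrite ltnn.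
  by rewrite ltnNge (ltnW ji).
have [E HE] : exists E, E \notin codom f.
  apply/existsP; rewrite -[[exists _, _]]negbK negb_exists; apply/negP => /forallP H.
  have : #|'I_n.+1| <= #|codom f|.
    by apply/subset_leq_card/subsetP => x _; rewrite -[_ \in _]negbK H.
  by move/leq_trans/(_ (leq_image_card _ _)); rewrite !card_ord ltnn.
have f_lift i : f i = lift E i.
  rewrite (@order_iso_lift _ f E 1%g) ?perm1 // => [k|k l]; last by rewrite !perm1.
  by apply: contraNneq HE => <-; apply: codom_f.
exists E, (s E); apply/permP => x; case: (unliftP E x) => [k|] ->; last first.
  by rewrite lift_perm_id.
rewrite lift_perm_lift; apply: (@order_iso_lift _ (fun k => s (lift E k))) => [i|i j].
  by rewrite (inj_eq perm_inj) eq_sym neq_lift.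
by rewrite -!f_lift.
Qed.

(** A discrete intermediate value argument. *)
Lemma descent_crossing n (s : 'S_n) (x y : 'I_n) d : x <= y -> d <= s x -> s y < d ->
  exists i j : 'I_n, [/\ j = i.+1 :> nat, x <= i, j <= y, d <= s i & s j < d].
Proof.
move=> xy dx yd; have [k] : exists k, x + k = y by exists (y - x); lia.
elim: k x xy dx => [|k IH] x xy dx xk.
  have e : x = y by apply: val_inj => /=; lia.
  by move: dx; rewrite e leqNgt yd.
have lt : x.+1 < n by have := ltn_ord y; lia.
pose x' := Ordinal lt; have [dx'|xd'] := leqP d (s x'); last by exists x, x'; split=> //=; lia.
have [||i [j [ji xi jy di jd]]] := IH x' _ dx'; rewrite /=; [lia..|].
by exists i, j; split=> //; apply: ltnW.
Qed.

Lemma inord_bump m k v : v <= m -> k <= m.+1 ->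
  inord (bump k v) = lift (inord k) (inord v : 'I_m.+1) :> 'I_m.+2.
Proof.
move=> vm km; apply: val_inj; rewrite /= !inordK ?ltnS //.
by rewrite /bump; lia.
Qed.

(** Take the permutation of [Pi] with the lexicographically smallest inverse,
    and suppose that it has neighbours [c], [a] with [c > a + 1], where [a] is
    as small as possible. Inserting a letter [b] just above [a] in value and
    directly before [c] gives a permutation [... b c a ...] that contains an
    element of [Pi]; then so does the Knuth equivalent [... b a c ...]. By
    [letters_move_left] the element found there is earlier, a contradiction. *)
Lemma closed_unit_descents n (Pi : {set 'S_n}) s0 : s0 \in Pi ->
  {in Pi &, forall s s', Des s^-1 = Des s'^-1}%g ->
  (forall (s s' : 'S_n.+1) (t : 'S_n), P s = P s' -> t \in Pi -> contains s t ->
    exists2 t' : 'S_n, t' \in Pi & contains s' t') ->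
  exists2 s, s \in Pi & unit_descents s.
Proof.
case: n Pi s0 => [|m] Pi s0 s0Pi sameD closed; first by exists s0 => // -[].
have [s sPi earliest] := exists_earliest s0Pi; exists s => //.
pose bad (j : 'I_m.+1) := [exists i : 'I_m.+1, (j == i.+1 :> nat) && ((s j).+1 < s i)].
have [j0 bad_j0|no_bad] := pickP bad; last first.
  move=> i j ji sji; have := no_bad j; move/negbT; rewrite negb_exists.
  by move=> /forallP/(_ i); rewrite ji eqxx /=; lia.
have [j1 /existsP[i1 /andP[/eqP ji ac]] minj] := @arg_minnP _ j0 bad (fun j => s j) bad_j0.
exfalso.
pose a : nat := s j1; pose c : nat := s i1; pose p : nat := i1.
have jm := ltn_ord j1; have cm := ltn_ord (s i1).
(* The new letter has value [a + 1] and takes the position of [c]. *)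
pose B : 'I_m.+2 := inord a.+1; pose P0 : 'I_m.+2 := inord p.
pose J : 'I_m.+2 := inord p.+1; pose K : 'I_m.+2 := inord p.+2.
have Bv : B = a.+1 :> nat by rewrite inordK // /a; lia.
have Pv : P0 = p :> nat by rewrite inordK // /p; lia.
have Jv : J = p.+1 :> nat by rewrite inordK // /p; lia.
have Kv : K = p.+2 :> nat by rewrite inordK // /p; lia.
have Je : J = lift P0 i1 by apply: val_inj; rewrite /= Pv Jv /bump leqnn.
have Ke : K = lift P0 j1 by apply: val_inj; rewrite /= Pv Kv /bump ji; lia.
pose sig := lift_perm P0 B s.
have sigP : P (tperm J K * sig)%g = P sig.
  apply: (@knuth_move _ _ P0); rewrite ?Jv ?Kv ?Pv // /sig Je Ke !lift_perm_lift lift_perm_id.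
  by rewrite /= Bv /bump /a -/c; move: ac; rewrite -/c; lia.
have [t' t'Pi /contains_lift_perm[E [D e]]] : 
    exists2 t' : 'S_m.+1, t' \in Pi & contains (tperm J K * sig)%g t'.
  apply: closed (esym sigP) sPi _; apply/contains_lift_perm; by exists P0, B.
have eV : (lift_perm B P0 s^-1 * tperm J K = lift_perm D E t'^-1)%g.
  by rewrite -!lift_permV -e invMg tpermV.
pose t v : nat := (s^-1)%g (inord v : 'I_m.+1).
pose t2 v : nat := (t'^-1)%g (inord v : 'I_m.+1).
pose h v : nat := (lift_perm B P0 s^-1 * tperm J K)%g (inord v).
have tE (v : 'I_m.+1) : t v = (s^-1)%g v by rewrite /t inord_val.
have t2E (v : 'I_m.+1) : t2 v = (t'^-1)%g v by rewrite /t2 inord_val.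
have hE (v : 'I_m.+2) : h v = (lift_perm B P0 s^-1 * tperm J K)%g v.
  by rewrite /h inord_val.
have [] : (forall v, v <= a -> t2 v <= t v) /\ t2 a < t a.
  apply: (@letters_move_left m a c p D E t t2 h); rewrite ?/a ?/c ?/p //.
  - by rewrite tE permK ji.
  - by rewrite tE permK.
  - move=> v w vm wm /val_inj/perm_inj/(congr1 val) /=.
    by rewrite !inordK.
  - rewrite -/a -Bv hE permM lift_perm_id tpermD // -val_eqE /= ?Pv ?Jv ?Kv /p; lia.
  - have -> : val (s j1) = lift B (s j1) by rewrite /= Bv /bump /a; lia.
    by rewrite hE permM lift_perm_lift permK -Ke tpermR Jv.
  - move=> v vm va vc; rewrite -/a /h inord_bump -/B; [|lia|by rewrite /a; lia].
    rewrite permM lift_perm_lift.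
    set x := (s^-1)%g (inord v); have sx : s x = v :> nat by rewrite permKV inordK.
    have xi : x != i1 by apply/eqP => xi; apply: vc; rewrite /c -sx xi.
    have xj : x != j1 by apply/eqP => xj; apply: va; rewrite -sx xj.
    move: xi xj; rewrite -!val_eqE /= ji => xi xj.
    rewrite tpermD -?val_eqE /= ?Pv ?Jv ?Kv /bump /t -/x /p; lia.
  - by rewrite hE eV lift_perm_id.
  - by have := ltn_ord D; lia.
  - move=> v vm; rewrite /t2 /h eV.
    have -> : inord (bump D v) = lift D (inord v : 'I_m.+1).
      by rewrite -[in RHS](inord_val D) inord_bump //; have := ltn_ord D; lia.
    by rewrite lift_perm_lift.
  - move=> v vm; have vv : (inord v.+1 : 'I_m.+1) = (inord v : 'I_m.+1).+1 :> nat.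
      by rewrite !inordK //; lia.
    by rewrite /t /t2 -!(mem_Des _ vv) (sameD _ _ sPi t'Pi).
  - move=> d u ud da; rewrite tE permK => ju ud'.
    have um : u < m.+1 by lia.
    have [||i [j [ij _ ju' di jd]]] := @descent_crossing _ s j1 (s^-1 (inord u))%g d (ltnW ju).
    + by rewrite ltnW.
    + by rewrite permKV inordK.
    (* The value [d] stands to the right of [u], so this descent jumps over it. *)
    have id : s i != d :> nat.
      apply/eqP => id; move: ud'; rewrite -id tE permK; move: ju'; rewrite ij /t; lia.
    have /minj : bad j by apply/existsP; exists i; rewrite ij eqxx /=; lia.
    by rewrite leqNgt (ltn_trans jd da).
move=> le lt; apply: (earliest t' t'Pi); exists (s j1); split=> [v /le|].
  by rewrite tE t2E.
by move: lt; rewrite tE t2E.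
Qed.

(** * Layered permutations in a Knuth class *)

(** In the earliest element a swappable descent cannot occur, since the swap
    moves only its smaller letter to the left. *)
Lemma swap_closed_unit_descents n (Pi : {set 'S_n}) s0 : s0 \in Pi -> swap_closed Pi ->
  exists2 s, s \in Pi & unit_descents s.
Proof.
move=> s0Pi swp; have [s sPi earliest] := exists_earliest s0Pi; exists s => //.
move=> i j ji sji; apply/eqP; case: eqP => // sij.
case: (earliest (tperm i j * s)%g); first by apply: swp => //; lia.
exists (s j); rewrite invMg tpermV !permM permK tpermR ji; split=> // v vj.
rewrite permM; case: tpermP => [e|e|//]; last by rewrite e ji.
by move: vj; rewrite -[v](permKV s) e; lia.
Qed.

(** If [v] stands before [v + 1], every value up to [v] stands before every
    larger value: otherwise some descent crosses from above [v] to at most [v],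
    and being a unit descent it has [v + 1] directly before [v]. *)
Lemma unit_descents_layered n (s : 'S_n) (v w u u' : 'I_n) : unit_descents s ->
  w = v.+1 :> nat -> (s^-1 v < s^-1 w)%g -> u <= v -> v < u' -> (s^-1 u < s^-1 u')%g.
Proof.
move=> us wv asc uv vu'; rewrite ltnNge; apply/negP => le.
have [||i [j [ji _ _ vi jv]]] := @descent_crossing _ s _ _ v.+1 le; rewrite ?permKV //.
have e := us i j ji (leq_trans jv vi).
have ei : s i = w by apply: val_inj => /=; lia.
have ej : s j = v by apply: val_inj => /=; lia.
by move: asc; rewrite -ei -ej !permK ji; lia.
Qed.

Lemma sorted_subseq2 u a b : sorted ltn u -> a \in u -> b \in u -> a < b ->
  subseq [:: a; b] u.
Proof.
move=> su au bu ab; have -> : [:: a; b] = [seq x <- u | x \in [:: a; b]].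
  apply: (irr_sorted_eq ltn_trans ltnn); rewrite /= ?ab //.
    exact: (subseq_sorted ltn_trans (filter_subseq _ _)).
  move=> x; rewrite mem_filter andb_idr //.
  by rewrite !inE => /orP[]/eqP->.
exact: filter_subseq.
Qed.

(** A V-word without small letters is an increasing one, so the length of the
    longest increasing subsequence is a Knuth invariant. *)
Lemma has_vword_increasing r w : uniq w ->
  has_vword 0 r w <-> exists u, [/\ subseq u w, sorted ltn u & size u = r.+1].
Proof.
move=> Uw; split=> [[m [u [sub [hu pu c0 cr]]]]|[[|m u] [sub su // sz]]].
  have Uu := subseq_uniq sub Uw; exists u; split=> //.
    rewrite ltn_sorted_uniq_leq Uu; apply: pairwise_sorted.
    apply: (@sub_in_pairwise _ (leq m)) pu => [a b am bm|].
      by move: am bm; rewrite !unfold_in /vrel; lia.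
    apply/allP => a au; rewrite leqNgt; apply/negP => am.
    by have : 0 < count (ltn^~ m) u by [rewrite -has_count; apply/hasP; exists a]; rewrite c0.
  have mu : m \in u by case: (u) hu => //= a l [->]; rewrite mem_head.
  by rewrite (count_lt_gt Uu mu) c0 cr.
have mlt : all (ltn m) u by rewrite (order_path_min ltn_trans).
exists m, (m :: u); split=> //; split=> //.
- move: su; rewrite (sorted_pairwise ltn_trans); apply: (@sub_in_pairwise _ (leq m)).
    by move=> a b; rewrite !unfold_in /vrel /=; lia.
  by rewrite /= leqnn; apply: sub_all mlt => x /ltnW.
- by apply/eqP; rewrite /= ltnn -leqn0 leqNgt -has_count -all_predC;
     apply: sub_all mlt => x /=; rewrite -leqNgt => /ltnW.
by move: sz => /= [<-]; rewrite ltnn; apply/eqP; rewrite -all_count.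
Qed.

Definition increasing_set n (s : 'S_n) (B : {set 'I_n}) : Prop :=
  {in B &, forall v w : 'I_n, v < w -> (s^-1 v < s^-1 w)%g}.

Lemma increasing_set_subseq n (s : 'S_n) r :
  (exists2 B, increasing_set s B & #|B| = r) <->
  (exists u, [/\ subseq u (word s), sorted ltn u & size u = r]).
Proof.
split=> [[B incB <-]|[u [sub su <-]]].
  have sB : sorted ltn (map val (enum B)).
    apply: (subseq_sorted ltn_trans (s2 := map val (enum 'I_n))).
      by apply: map_subseq; rewrite {1}/enum_mem -enumT filter_subseq.
    by rewrite val_enum_ord iota_ltn_sorted.
  exists [seq v.+1 | v <- map val (enum B)]; split.
  - apply/subseq_wordP; exists [seq (s^-1)%g v | v <- enum B]; last first.
      by rewrite -!map_comp; apply: eq_map => v /=; rewrite permKV.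
    rewrite -map_comp sorted_map sorted_pairwise; last by move=> ? ? ? /=; apply: ltn_trans.
    move: sB; rewrite sorted_map sorted_pairwise; last by move=> ? ? ? /=; apply: ltn_trans.
    apply: (@sub_in_pairwise _ (mem B)); last by apply/allP => v; rewrite mem_enum.
    by move=> v w vB wB /=; apply: incB.
  - by rewrite sorted_map; apply: sub_sorted sB => x y.
  - by rewrite !size_map -cardE.
have /subseq_wordP[x _ eu] := sub.
have Ux : uniq x by apply: (@map_uniq _ _ (fun i => (s i).+1)); rewrite -eu;
  apply: subseq_uniq sub (word_uniq s).
exists [set s i | i in x].
  move=> v w /imsetP[i ix ->] /imsetP[j jx ->] ij; rewrite -before_word.
  apply: subseq_trans (sorted_subseq2 su _ _ _) sub; rewrite ?ltnS // eu.
    by rewrite map_f.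
  by apply: (map_f (fun i => (s i).+1)).
rewrite card_imset; last exact: perm_inj.
by rewrite eu size_map; apply/card_uniqP.
Qed.

Lemma increasing_set_P n (s s' : 'S_n) (B : {set 'I_n}) : 0 < #|B| -> P s = P s' -> increasing_set s B ->
  exists2 B' : {set 'I_n}, increasing_set s' B' & #|B'| = #|B|.
Proof.
move=> B0 ss' incB; apply/increasing_set_subseq; rewrite -(prednK B0).
apply/has_vword_increasing; first exact: word_uniq.
apply: (P_has_vword ss'); apply/has_vword_increasing; first exact: word_uniq.
by rewrite prednK //; apply/increasing_set_subseq; exists B.
Qed.

Lemma reverse_inv_lt n (s : 'S_n) i j :
  ((reverse s)^-1 i < (reverse s)^-1 j)%g = (s^-1 j < s^-1 i)%g.
Proof.
rewrite !reverse_inv /=.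
by have := ltn_ord (s^-1 i)%g; have := ltn_ord (s^-1 j)%g; lia.
Qed.

(** In [s] the values that stand before their successor, together with the
    largest value, form an increasing subsequence. So [s'] has one of the same
    length. By [unit_descents_layered] for the reversal, an increasing
    subsequence of [s'] stays in a range of values without inverse descents;
    by its length it exhausts the values that stand before their successor. *)
Lemma ascents_interval n (s s' : 'S_n) : P s = P s' ->
  unit_descents s -> unit_descents (reverse s') ->
  exists x y : nat, forall v w : 'I_n, w = v.+1 :> nat ->
    (s^-1 v < s^-1 w)%g = (x <= v < y).
Proof.
case: n s s' => [|n] s s' ss' us us'; first by exists 0, 0 => -[].
pose A := [set v : 'I_n.+1 |
  [exists w : 'I_n.+1, (w == v.+1 :> nat) && (s^-1 v < s^-1 w)%g]].
have AE (v w : 'I_n.+1) : w = v.+1 :> nat -> (v \in A) = (s^-1 v < s^-1 w)%g.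
  move=> wv; rewrite inE; apply/existsP/idP => [[w' /andP[/eqP e]]|lt].
    by have -> : w' = w by apply: val_inj => /=; lia.
  by exists w; rewrite wv eqxx.
have maxA : ord_max \notin A.
  by rewrite inE; apply/existsP => -[w /andP[/eqP e _]]; have := ltn_ord w; rewrite e ltnn.
have incA : increasing_set s (ord_max |: A).
  move=> v w /setU1P[->|vA] _ vw; first by have := ltn_ord w; rewrite /= in vw; lia.
  have vn : v.+1 < n.+1 by apply: leq_ltn_trans vw (ltn_ord w).
  by apply: (@unit_descents_layered _ _ v (Ordinal vn)) => //; rewrite -AE.
have [|U incU cardU] := increasing_set_P _ ss' incA; first by rewrite cardsU1 maxA.
have {cardU} cU : #|U| = #|A|.+1 by rewrite cardU cardsU1 maxA.
have [u0 u0U] : exists u0, u0 \in U by apply/card_gt0P; rewrite cU.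
have [x xU xmin] := @arg_minnP _ u0 (mem U) val u0U.
have [y yU ymax] := @arg_maxnP _ u0 (mem U) val u0U.
(* If [v + 1] came before [v], then [y] would come before [x] in [s']. *)
have itvA (v : 'I_n.+1) : x <= v < y -> v \in A.
  case/andP=> xv vy; have vn : v.+1 < n.+1 by apply: leq_ltn_trans vy (ltn_ord y).
  rewrite (AE _ (Ordinal vn)) // (inv_descents_P _ ss') //.
  have := incU _ _ xU yU (leq_ltn_trans xv vy).
  rewrite (@inv_lt_neg _ _ v); last by rewrite -val_eqE /=; lia.
  rewrite ltnNge; apply: contraNN => desc.
  by rewrite ltnW // -reverse_inv_lt (@unit_descents_layered _ _ v (Ordinal vn)) //
     reverse_inv_lt.
have below_y (v : 'I_n.+1) : v \in U :\ y -> x <= v < y.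
  rewrite !inE => /andP[vy vU]; rewrite xmin //=.
  by have := ymax v vU; rewrite /= leq_eqVlt val_eqE (negbTE vy).
have eqA : U :\ y = A.
  apply/eqP; rewrite eqEcard; apply/andP; split.
    by apply/subsetP => v /below_y/itvA.
  by rewrite -ltnS -cU (cardsD1 y U) (yU : y \in U).
exists x, y => v w wv; rewrite -(AE _ _ wv).
by apply/idP/idP => [|/itvA //]; rewrite -eqA => /below_y.
Qed.

(** By [ascents_interval], applied also to the reversals, both the ascending
    and the descending values form an interval; one of the two starts at the
    smallest value. *)
Lemma unit_descents_hook n (s s' : 'S_n) : 0 < n -> P s = P s' ->
  unit_descents s -> unit_descents (reverse s') ->
  exists p q, n = (p + q).+1 /\ (P s = column_hook p q \/ P s = row_hook p q).
Proof.
move=> n0 ss' us us'.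
have [x [y asc]] := ascents_interval ss' us us'.
have [|x' [y' desc']] := ascents_interval (P_reverse (esym ss')) us'.
  by rewrite reverseK.
have desc (v w : 'I_n) : w = v.+1 :> nat -> (s^-1 w < s^-1 v)%g = (x' <= v < y').
  move=> wv; rewrite -(desc' _ _ wv) reverse_inv_lt.
  have vw : w != v by rewrite -val_eqE /= wv; lia.
  by rewrite !(inv_lt_neg _ vw) (inv_descents_P wv ss').
(* Upper bounds of the two intervals may exceed the last ascent or descent,
   hence the truncation below. *)
have [d0|a0] := boolP (x' <= 0 < y').
  pose p := minn y' n.-1; have npq : n = (p + (n.-1 - p)).+1 by rewrite /p; lia.
  exists p, (n.-1 - p); split=> //; left; apply/(P_column_hook _ npq).
  rewrite DinvE; apply/eqP/(DesP _ (@itv1_gt0 _ _)) => v w wv.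
  by rewrite (desc _ _ wv) inE wv /p; have := ltn_ord w; lia.
pose p := minn y n.-1; have npq : n = (p + (n.-1 - p)).+1 by rewrite /p; lia.
exists p, (n.-1 - p); split=> //; right; apply/(P_row_hook _ npq).
rewrite DinvE; apply/eqP/DesP => [i|v w wv]; first by rewrite inE; lia.
have n1 : 1 < n by have := ltn_ord w; lia.
have asc0 := asc (Ordinal n0) (Ordinal n1) (erefl _).
rewrite inv_lt_neg // (desc (Ordinal n0) (Ordinal n1)) // (negbTE a0) /= in asc0.
have wv' : w != v by rewrite -val_eqE /= wv; lia.
rewrite (inv_lt_neg _ wv') (asc _ _ wv) inE wv.
by have := ltn_ord w; rewrite /p; lia.
Qed.

(** * The equivalences *)

Definition reversed n (Pi : {set 'S_n}) : {set 'S_n} := [set s | reverse s \in Pi].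

Lemma class_unit_descents_hook n S (Pi : {set 'S_n}) : 0 < n ->
  Pi = knuth_class n S ->
  (exists2 s, s \in Pi & unit_descents s) ->
  (exists2 s, s \in reversed Pi & unit_descents s) ->
  initial_or_final_Dinv Pi.
Proof.
move=> n0 hPi [s sPi us] [t tPi ut].
have Ps : P s = S by move: sPi; rewrite hPi inE => /eqP.
have Pt : P (reverse t) = S by move: tPi; rewrite inE hPi inE => /eqP.
apply/(initial_or_final_DinvP _ n0).
have [||p [q [npq H]]] := @unit_descents_hook _ s (reverse t) n0 _ us.
- by rewrite Ps.
- by rewrite reverseK.
by exists p, q; split=> //; case: H => <-; rewrite Ps; [left|right].
Qed.

Lemma pattern_knuth_closed_hook n S (Pi : {set 'S_n}) s0 : 0 < n ->
  Pi = knuth_class n S -> s0 \in Pi -> pattern_knuth_closed Pi ->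
  initial_or_final_Dinv Pi.
Proof.
move=> n0 hPi s0Pi /pattern_knuth_closedP closed.
have PS s : s \in Pi -> P s = S by rewrite hPi inE => /eqP.
apply: (class_unit_descents_hook n0 hPi).
  apply: (closed_unit_descents s0Pi) => [s s' /PS Ps /PS Ps'|]; last exact: closed.
  by apply: Des_P; rewrite Ps.
apply: (@closed_unit_descents _ _ (reverse s0)) => [|s s'|s s' t ss'].
- by rewrite inE reverseK.
- rewrite !inE => /PS Ps /PS Ps'; apply: Des_P.
  by rewrite -[s]reverseK -[s']reverseK; apply: P_reverse; rewrite Ps.
rewrite inE => tPi /contains_reverse st.
have [t' t'Pi st'] := closed _ _ _ _ (P_reverse ss') tPi st.
exists (reverse t'); first by rewrite inE reverseK.
by rewrite -[s']reverseK; apply: contains_reverse.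
Qed.

Lemma tperm_reverse n (s : 'S_n) i j :
  (tperm i j * reverse s)%g = reverse (tperm (rev_ord i) (rev_ord j) * s)%g.
Proof.
apply/permP => k; rewrite permM !reverseE permM; congr (s _).
case: tpermP => [->|->|/eqP ki /eqP kj]; rewrite ?tpermL ?tpermR //.
by rewrite tpermD // (inj_eq rev_ord_inj) eq_sym.
Qed.

Lemma swap_closed_hook n S (Pi : {set 'S_n}) s0 : 0 < n ->
  Pi = knuth_class n S -> s0 \in Pi -> swap_closed Pi ->
  initial_or_final_Dinv Pi.
Proof.
move=> n0 hPi s0Pi swp; apply: (class_unit_descents_hook n0 hPi).
  exact: swap_closed_unit_descents s0Pi swp.
apply: (@swap_closed_unit_descents _ _ (reverse s0)); first by rewrite inE reverseK.
move=> s i j; rewrite !inE => sPi ji sij.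
rewrite -[s]reverseK tperm_reverse reverseK tpermC; apply: swp => //.
  by rewrite /=; have := ltn_ord j; lia.
by rewrite !reverseE !rev_ordK; lia.
Qed.

Theorem theorem5p11 (n : nat) (hn : 0 < n) (S : tableau) (hS : is_SYT n S)
    (Pi : {set 'S_n}) (hPi : Pi = knuth_class n S) :
  [<-> pattern_knuth_closed Pi;
       swap_closed Pi;
       exists J : {set 'I_n}, Pi = Dinv J /\
         exists k : nat, (k <= n - 1 /\ J = itv n 1 k) \/
                         (1 <= k <= n /\ J = itv n k (n - 1));
       superstandard_hook S].
Proof.
have [s0 Ps0 _] := knuth_class_reading hS.
have s0Pi : s0 \in Pi by rewrite hPi inE Ps0.
have iffE := initial_or_final_superstandard hn hS hPi.
tfae.
- by move/(pattern_knuth_closed_hook hn hPi s0Pi) => [J [-> _]]; apply: Dinv_swap_closed.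
- exact: swap_closed_hook hn hPi s0Pi.
- by move/iffE.
- by move/iffE/(initial_or_final_closed hn).
Qed.
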